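(* Let $S$ be a regular interval exchange set on the finite alphabet $A$. Then $S$ has the finite index basis property: a finite bifix code $X\subset S$ is an $S$-maximal bifix code of $S$-degree $d$ if and only if $X$ is a basis of a subgroup of index $d$ of the free group $F_A$ on $A$.
   Context: For a finite alphabet $A$ with two total orders $<_1,<_2$ and a partition $(I_a)_{a\in A}$ of $[0,1[$ into nonempty semi-intervals $[\alpha,\beta[$ ordered for $<_1$ (i.e. $a<_1 b$ implies $I_a$ lies to the left of $I_b$), set $\lambda_a=|I_a|$, $\mu_a=\sum_{b\le_1 a}\lambda_b$, $\nu_a=\sum_{b\le_2 a}\lambda_b$, $\alpha_a=\nu_a-\mu_a$; the interval exchange transformation relative to $(I_a)$ is $T(z)=z+\alpha_a$ for $z\in I_a$. Writing $A=\{a_1<_1\cdots<_1a_s\}$, $\mu_i=\mu_{a_i}$, $T$ is regular if the orbits $\{T^n(\mu_i)\mid n\in\mathbb{Z}\}$, $1\le i\le s-1$, are infinite and pairwise disjoint; regular transformations are minimal (every orbit dense). The natural coding $\Sigma_T(z)=a_0a_1\cdots$ has $a_n=a$ iff $T^n(z)\in I_a$; for minimal $T$ the set $F(T)$ of factors of $\Sigma_T(z)$ does not depend on $z$. A regular interval exchange set is a set $F(T)$ with $T$ a regular interval exchange transformation. A bifix code is a set of nonempty words none of which is a proper prefix or proper suffix of another; a bifix code $X\subset S$ is $S$-maximal if not properly contained in any bifix code $Y\subset S$. A parse of a word $w$ with respect to a bifix code $X$ is a triple $(v,x,u)$ with $w=vxu$, $x\in X^*$, $v$ having no suffix in $X$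 and $u$ having no prefix in $X$; the $S$-degree of $X$ is the maximal number of parses of a word of $S$. *)

(* Defs.v *)
From HB Require Import structures.
From mathcomp Require Import all_boot all_order all_algebra.
From mathcomp Require Import boolp classical_sets functions cardinality.
From mathcomp Require Import set_interval reals.

Set Implicit Arguments.
Unset Strict Implicit.
Unset Printing Implicit Defensive.

Import Order.TTheory GRing.Theory Num.Theory.

Local Open Scope classical_set_scope.
Local Open Scope group_scope.

(* (a, false) is the letter a, (a, true) its formal inverse; the elements of
   the free group are the reduced words over these signed letters. *)

Definition flip (A : Type) (x : A * bool) : A * bool := (x.1, ~~ x.2).

Definition reduced (A : eqType) (w : seq (A * bool)) : bool :=
  sorted (fun x y => y != flip x) w.

Record free_group (A : choiceType) :=
  FreeGroup { fg_word :> seq (A * bool); fg_reduced : reduced fg_word }.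

HB.instance Definition _ (A : choiceType) := [isSub for @fg_word A].
HB.instance Definition _ (A : choiceType) :=
  [Choice of free_group A by <:].

Definition fg_push (A : eqType) (x : A * bool) (w : seq (A * bool)) :=
  if w is y :: w' then if y == flip x then w' else x :: w else [:: x].

Lemma flipK (A : Type) : involutive (@flip A).
Proof. by case=> a b; rewrite /flip /= negbK. Qed.

Lemma fg_push_reduced (A : eqType) (x : A * bool) w :
  reduced w -> reduced (fg_push x w).
Proof.
case: w => [|y w] //= rw; case: ifPn => [_|yx]; first exact: path_sorted rw.
by rewrite /reduced /= yx.
Qed.

Lemma foldr_push_reduced (A : eqType) (u w : seq (A * bool)) :
  reduced w -> reduced (foldr (@fg_push A) w u).
Proof. by move=> rw; elim: u => //= x u IH; apply: fg_push_reduced. Qed.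

Lemma rev_flip_reduced (A : eqType) (w : seq (A * bool)) :
  reduced w -> reduced (rev (map (@flip A) w)).
Proof.
rewrite /reduced rev_sorted sorted_map; apply: sub_sorted => x y /=.
by rewrite flipK eq_sym.
Qed.

Definition fg_one (A : choiceType) : free_group A :=
  @FreeGroup A [::] erefl.
Definition fg_mul (A : choiceType) (u v : free_group A) : free_group A :=
  FreeGroup (foldr_push_reduced u (fg_reduced v)).
Definition fg_inv (A : choiceType) (u : free_group A) : free_group A :=
  FreeGroup (rev_flip_reduced (fg_reduced u)).

Lemma fg_pushK (A : eqType) (x : A * bool) w :
  reduced w -> fg_push x (fg_push (flip x) w) = w.
Proof.
case: w => [|y w] /=; first by rewrite eqxx.
rewrite flipK; case: eqVneq => [->|yx] rw; last by rewrite /= eqxx.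
by case: w rw => [|z w] //= /andP[/negPf->].
Qed.

Lemma foldr_push_id (A : eqType) (w : seq (A * bool)) :
  reduced w -> foldr (@fg_push A) [::] w = w.
Proof.
elim: w => //= x w IH rw; rewrite IH; last exact: path_sorted rw.
by case: w rw {IH} => [|y w] //= /andP[/negPf->].
Qed.

Lemma foldr_push_push (A : eqType) (x : A * bool) u w : reduced w ->
  foldr (@fg_push A) w (fg_push x u) = fg_push x (foldr (@fg_push A) w u).
Proof.
move=> rw; case: u => [|y u] //=; case: eqP => [->|//] /=.
by rewrite fg_pushK //; apply: foldr_push_reduced.
Qed.

Lemma fg_mulA (A : choiceType) : associative (@fg_mul A).
Proof.
move=> u v w; apply: val_inj => /=; case: u => u ru /=; elim: u {ru} => //= x u ->.
by rewrite foldr_push_push //; apply: fg_reduced.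
Qed.

Lemma fg_mul1g (A : choiceType) : left_id (fg_one A) (@fg_mul A).
Proof. by move=> u; apply: val_inj. Qed.

Lemma fg_mulg1 (A : choiceType) : right_id (fg_one A) (@fg_mul A).
Proof. by case=> u ru; apply: val_inj; apply: foldr_push_id. Qed.

Lemma fg_mulVg (A : choiceType) : left_inverse (fg_one A) (@fg_inv A) (@fg_mul A).
Proof.
case=> u ru; apply: val_inj => /=.
suff H (w : seq (A * bool)) : reduced w ->
    foldr (@fg_push A) (foldr (@fg_push A) w u) (rev (map (@flip A) u)) = w.
  by have /= := H [::] isT; rewrite foldr_push_id.
elim: u {ru} w => //= x u IH w rw.
rewrite rev_cons foldr_rcons -{2}[x]flipK fg_pushK ?IH //.
exact: foldr_push_reduced.
Qed.

Lemma fg_invK (A : choiceType) : involutive (@fg_inv A).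
Proof.
case=> u ru; apply: val_inj => /=.
by rewrite map_rev revK mapK //; apply: flipK.
Qed.

Lemma fg_mulgV (A : choiceType) : right_inverse (fg_one A) (@fg_inv A) (@fg_mul A).
Proof. by move=> u; rewrite -{1}[u]fg_invK fg_mulVg. Qed.

HB.instance Definition _ (A : choiceType) := isGroup.Build (free_group A)
  (@fg_mulA A) (@fg_mul1g A) (@fg_mulg1 A) (@fg_mulVg A) (@fg_mulgV A).

Definition fg_gen (A : choiceType) (a : A) : free_group A :=
  @FreeGroup A [:: (a, false)] erefl.

Definition word_in_fg (A : choiceType) (w : seq A) : free_group A :=
  \prod_(a <- w) fg_gen a.

(* The homomorphism free_group A -> G extending f. *)
Definition fg_lift (A : choiceType) (G : groupType) (f : A -> G)
    (w : free_group A) : G :=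
  \prod_(x <- w) (if x.2 then (f x.1)^-1 else f x.1).

Lemma fg_liftM (A : choiceType) (G : groupType) (f : A -> G) :
  {morph fg_lift f : u v / u * v}.
Proof.
case=> u ru [v rv]; rewrite /fg_lift /= {rv}; elim: u {ru} => [|x u IH] /=.
  by rewrite big_nil mul1g.
rewrite big_cons -mulgA -IH; case: (foldr _ v u) => [|y w] /=.
  by rewrite big_cons.
case: eqP => [->|_]; rewrite !big_cons //= mulgA; case: x.2 => /=.
  by rewrite mulVg mul1g.
by rewrite mulgV mul1g.
Qed.

Lemma fg_lift_gen (A : choiceType) (G : groupType) (f : A -> G) a :
  fg_lift f (fg_gen a) = f a.
Proof. by rewrite /fg_lift big_seq1. Qed.

Definition subgroup (G : groupType) (H : set G) : Prop :=
  [/\ H 1, forall x y, H x -> H y -> H (x * y) & forall x, H x -> H x^-1].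

Definition right_cosets (G : groupType) (H : set G) : set (set G) :=
  range (fun g : G => [set h * g | h in H]).

Definition has_index (G : groupType) (H : set G) (d : nat) : Prop :=
  (right_cosets H #= `I_d)%card.

(* B is a basis of H: H is freely generated by B, i.e. the canonical
   homomorphism from the free group on the set B to G is injective and has
   image H. *)
Definition is_basis (G : groupType) (B H : set G) : Prop :=
  injective (fg_lift (val : B -> G)) /\ range (fg_lift (val : B -> G)) = H.

Definition bifix_code (A : eqType) (X : set (seq A)) : Prop :=
  [/\ ~ X [::],
      forall x y, X x -> X y -> prefix x y -> x = y
    & forall x y, X x -> X y -> suffix x y -> x = y].

Definition maximal_bifix_code (A : eqType) (S X : set (seq A)) : Prop :=
  [/\ bifix_code X, X `<=` S
    & forall Y, bifix_code Y -> Y `<=` S -> X `<=` Y -> X = Y].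

Definition star (A : eqType) (X : set (seq A)) : set (seq A) :=
  [set flatten s | s in [set s : seq (seq A) | forall x, x \in s -> X x]].

Definition parses (A : eqType) (X : set (seq A)) (w : seq A) :
    set (seq A * seq A * seq A) :=
  [set p | let: (v, x, u) := p in
    [/\ w = v ++ x ++ u, star X x,
        forall y, X y -> ~~ suffix y v & forall y, X y -> ~~ prefix y u]].

(* The S-degree of X is d: d is attained, and is an upper bound. *)
Definition has_degree (A : eqType) (S X : set (seq A)) (d : nat) : Prop :=
  (exists2 w, S w & (parses X w #= `I_d)%card) /\
  (forall w, S w -> (parses X w #<= `I_d)%card).

Definition finite_index_basis_property (A : choiceType) (S : set (seq A)) :
    Prop :=
  forall (X : set (seq A)) (d : nat),
    finite_set X -> bifix_code X -> X `<=` S ->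
    (maximal_bifix_code S X /\ has_degree S X d) <->
    (exists H : set (free_group A),
      [/\ subgroup H, has_index H d & is_basis (@word_in_fg A @` X) H]).

Local Open Scope ring_scope.

Definition total_order (A : Type) (le : rel A) : Prop :=
  [/\ total le, antisymmetric le & transitive le].

(* The interval I_a is `[iet_lo a, iet_hi a[; that it is nonempty is part of
   the definition of partition. *)
Record interval_exchange (R : realType) (A : finType) := IntervalExchange {
  iet_le1 : rel A;
  iet_le2 : rel A;
  iet_lo : A -> R;
  iet_hi : A -> R;
  iet_le1_order : total_order iet_le1;
  iet_le2_order : total_order iet_le2;
  iet_partition :
    partition [set: A] (fun a => [set` `[iet_lo a, iet_hi a[]) [set` `[0, 1[];
  iet_ordered : forall a b, a != b -> iet_le1 a b ->
    forall x y, x \in `[iet_lo a, iet_hi a[ -> y \in `[iet_lo b, iet_hi b[ ->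
    x < y
}.

Definition iet_lambda (R : realType) (A : finType)
    (T : interval_exchange R A) (a : A) : R := iet_hi T a - iet_lo T a.

Definition iet_mu (R : realType) (A : finType)
    (T : interval_exchange R A) (a : A) : R :=
  \sum_(b | iet_le1 T b a) iet_lambda T b.

Definition iet_nu (R : realType) (A : finType)
    (T : interval_exchange R A) (a : A) : R :=
  \sum_(b | iet_le2 T b a) iet_lambda T b.

Definition iet_alpha (R : realType) (A : finType)
    (T : interval_exchange R A) (a : A) : R := iet_nu T a - iet_mu T a.

(* Only the values on `[0, 1[ matter; the map is extended by the identity. *)
Definition iet_map (R : realType) (A : finType)
    (T : interval_exchange R A) (z : R) : R :=
  if [pick a | z \in `[iet_lo T a, iet_hi T a[] is Some a
  then z + iet_alpha T a else z.

(* T^n for n in Z, T being a bijection of `[0, 1[ onto itself. *)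
Definition iet_iter (R : realType) (A : finType)
    (T : interval_exchange R A) (n : int) (z : R) : R :=
  match n with
  | Posz k => iter k (iet_map T) z
  | Negz k => iter k.+1 ('pinv_id [set` `[0, 1[] (iet_map T)) z
  end.

Definition iet_orbit (R : realType) (A : finType)
    (T : interval_exchange R A) (z : R) : set R :=
  range (fun n : int => iet_iter T n z).

(* The indices 1 <= i <= s - 1 are the letters that are not maximal for <_1. *)
Definition iet_separation_letter (R : realType) (A : finType)
    (T : interval_exchange R A) (a : A) : Prop :=
  exists2 b, a != b & iet_le1 T a b.

Definition iet_regular (R : realType) (A : finType)
    (T : interval_exchange R A) : Prop :=
  (forall a, iet_separation_letter T a ->
    infinite_set (iet_orbit T (iet_mu T a))) /\
  (forall a b, iet_separation_letter T a -> iet_separation_letter T b ->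
    a != b -> iet_orbit T (iet_mu T a) `&` iet_orbit T (iet_mu T b) = set0).

Definition natural_coding (R : realType) (A : finType)
    (T : interval_exchange R A) (z : R) (u : nat -> A) : Prop :=
  forall (n : nat) (a : A),
    u n = a <-> iter n (iet_map T) z \in `[iet_lo T a, iet_hi T a[.

Definition factors (A : Type) (u : nat -> A) : set (seq A) :=
  [set w | exists i : nat, w = mkseq (fun k => u (i + k)%N) (size w)].

(* F(T) is the set of factors of the coding of a point z. As S may come from
   any z, the independence of F(T) from z is not assumed. *)
Definition regular_interval_exchange_set (R : realType) (A : finType)
    (S : set (seq A)) : Prop :=
  exists T : interval_exchange R A, iet_regular T /\
  exists (z : R) (u : nat -> A),
    [/\ z \in `[0, 1[, natural_coding T z u & S = factors u].

(* Main.v *)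
(** The factor language of a regular interval exchange is a tree language: for
    a word u with cylinder I_u, the incoming letters cut I_u into semi-intervals
    in one order, the outgoing letters cut it in another, and regularity says
    that no two interior cut points coincide, so that reading the cells from
    left to right builds the extension graph of u as a tree.

    For a tree language every cocycle on a Rauzy graph with values in a group is
    cohomologous to one that only depends on the last letter (acyclicity), and
    every equivariant function on the vertices is constant (connectedness).
    Given a bifix code X, let the words act on the tails of words without prefix
    in X, a tail being reset to the empty word with weight x when it reaches
    x in X.  Trivializing this cocycle with weights in the free group on X
    extends it to an action of F_A on which X acts as a free family; hence X is
    a basis of the subgroup K it generates, and the words of the language lying
    in K are in X*.  If X has finite S-degree, all long words w have the maximal
    number of parses, and connectedness makes the union of the cosets K u, for u
    a tail of w, invariant under F_A: the index of K is the S-degree.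

    Uniform recurrence, which makes the maximal number of parses be attained on
    all long words, follows from the tree structure as well: the orbit of a
    separation point meets the words starting with a first occurrence of w at
    most once, so that w returns in bounded time, and connectedness of the Rauzy
    graph spreads w to all long words. *)

Require Import Defs.
From HB Require Import structures.
From mathcomp Require Import all_boot all_order all_algebra perm.
From mathcomp Require Import boolp classical_sets functions cardinality.
From mathcomp Require Import set_interval reals lra.

Set Implicit Arguments.
Unset Strict Implicit.
Unset Printing Implicit Defensive.

Import Order.TTheory GRing.Theory Num.Theory.


(** * Tree languages *)

Local Open Scope classical_set_scope.

Section TreeLanguages.
Local Open Scope nat_scope.
Variable A : choiceType.
Implicit Types (L : set (seq A)) (u v w : seq A) (a b : A).

(* The bipartite graph with edge list [s] is a tree: read from the right, each
   new edge has exactly one endpoint among the earlier ones. *)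
Fixpoint tree_order (s : seq (A * A)) : bool :=
  if s is e :: s' then
    tree_order s' &&
    ((s' == [::]) || ((e.1 \in map fst s') != (e.2 \in map snd s')))
  else true.

Definition extension_tree L u : Prop :=
  exists2 s, tree_order s & forall a b, (a, b) \in s <-> L (a :: rcons u b).

Record tree_language L : Prop := TreeLanguage {
  tree_factor : forall u v w, L (u ++ v ++ w) -> L v;
  tree_extl : forall w, L w -> exists a, L (a :: w);
  tree_extr : forall w, L w -> exists b, L (rcons w b);
  tree_nil : L [::];
  tree_letter : forall a, L [:: a];
  tree_extension : forall u, L u -> extension_tree L u
}.

(** Each edge after the first shares an endpoint with an earlier one: a common left endpoint carries
    the value of [h] over, and a common right endpoint does so by the hypothesis on [h]. *)
Lemma tree_order_connected (T : Type) (s : seq (A * A)) (h : A -> T) :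
  tree_order s ->
  (forall e e', e \in s -> e' \in s -> e.2 = e'.2 -> h e.1 = h e'.1) ->
  forall e e', e \in s -> e' \in s -> h e.1 = h e'.1.
Proof.
elim: s => //= e0 s IH /andP[ts es] hs.
have IHs := IH ts (fun e e' es es' =>
  hs e e' (mem_behead (es : e \in behead (e0 :: s)))
          (mem_behead (es' : e' \in behead (e0 :: s)))).
have h0 e : e \in s -> h e0.1 = h e.1.
  move=> ine; case/orP: es => [/eqP s0|]; first by move: ine; rewrite s0.
  case: (boolP (e0.1 \in _)) => [/mapP[e1 e1s ->] _|_].
    exact: IHs.
  case: (boolP (e0.2 \in _)) => [/mapP[e1 e1s e01] _|//].
  rewrite (hs e0 e1) ?mem_head ?inE ?e1s ?orbT //; exact: IHs.
move=> e e'; rewrite !inE => /predU1P[->|ein] /predU1P[->|ein'] //.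
- exact: h0.
- by rewrite -(h0 e).
- exact: IHs.
Qed.

(** Each new edge has a fresh endpoint, where the value of [h] or [k] is still free and can be
    chosen to solve the equation of that edge. *)
Lemma tree_order_split (G : groupType) (s : seq (A * A)) (phi : A -> A -> G) :
  tree_order s ->
  exists h k : A -> G, forall e, e \in s -> phi e.1 e.2 = (h e.1 * k e.2)%g.
Proof.
elim: s => [_|[a b] s IH /= /andP[/IH[h [k hk]] es]].
  by exists (fun=> 1%g), (fun=> 1%g).
have [ain|aout] := boolP (a \in map fst s); last first.
  exists (fun x => if x == a then phi a b * (k b)^-1 else h x)%g, k => e.
  rewrite inE => /predU1P[->|ein]; first by rewrite /= eqxx mulgVK.
  by case: eqP => [ea|_]; [rewrite -ea map_f in aout | apply: hk].
have bout : b \notin map snd s.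
  by move: es ain => /orP[/eqP->//|] /[swap] ->; case: (b \in _).
exists h, (fun x => if x == b then (h a)^-1 * phi a b else k x)%g => e.
rewrite inE => /predU1P[->|ein]; first by rewrite /= eqxx mulVKg.
by case: eqP => [eb|_]; [rewrite -eb map_f in bout | apply: hk].
Qed.

Section Fixed.
Variable L : set (seq A).
Hypothesis tL : tree_language L.

Lemma tree_catl u v : L (u ++ v) -> L u.
Proof. by move=> Luv; exact: (@tree_factor _ tL [::] u v). Qed.

Lemma tree_catr u v : L (u ++ v) -> L v.
Proof. by move=> Luv; apply: (@tree_factor _ tL u v [::]); rewrite cats0. Qed.

Lemma tree_extl_size w n : L w -> exists2 v, size v = n & L (v ++ w).
Proof.
move=> Lw; elim: n => [|n [v sv Lv]]; first by exists [::].
by have [a La] := tree_extl tL Lv; exists (a :: v); rewrite //= sv.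
Qed.

Lemma tree_extr_size w n : L w -> exists2 v, size v = n & L (w ++ v).
Proof.
move=> Lw; elim: n => [|n [v sv Lv]]; first by exists [::]; rewrite ?cats0.
have [b Lb] := tree_extr tL Lv; exists (rcons v b); rewrite ?size_rcons ?sv //.
by rewrite -rcons_cat.
Qed.

Lemma tree_connected (T : Type) u (h : A -> T) : L u ->
  (forall a a' b, L (a :: rcons u b) -> L (a' :: rcons u b) -> h a = h a') ->
  forall a a', L (a :: u) -> L (a' :: u) -> h a = h a'.
Proof.
move=> Lu hE a a' /(tree_extr tL)[b Lb] /(tree_extr tL)[b' Lb'].
have [s ts sE] := tree_extension tL Lu.
apply: (@tree_order_connected T s h ts _ (a, b) (a', b')); rewrite ?sE //.
by move=> [x y] [x' y'] /sE Lx /sE Lx' /= yy; subst y'; apply: hE Lx Lx'.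
Qed.

(* Cocycles on the Rauzy graph of order n with values in a group are, up to
   a coboundary, pulled back from maps on letters: the tree condition lets one
   decrease n one step at a time. *)
Lemma tree_cocycle (G : groupType) n (phi : seq A -> G) :
  exists (g : seq A -> G) (psi : A -> G), forall w b, size w = n ->
    L (rcons w b) ->
    phi (rcons w b) = (g w * psi b * (g (behead (rcons w b)))^-1)%g.
Proof.
elim: n phi => [|n IH] phi.
  exists (fun=> 1%g), (fun b => phi [:: b]) => w b /size0nil-> _ /=.
  by rewrite mul1g invg1 mulg1.
have split u : exists hk : (A -> G) * (A -> G), L u -> forall a b,
    L (a :: rcons u b) -> phi (a :: rcons u b) = (hk.1 a * hk.2 b)%g.
  have [Lu|nLu] := pselect (L u); last by exists (fun=> 1%g, fun=> 1%g).
  have [s ts sE] := tree_extension tL Lu.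
  have [h [k hk]] :=
    tree_order_split (fun a b => phi (a :: rcons u b)) ts.
  by exists (h, k) => _ a b /sE/hk.
have [hk hkE] := choice split.
(* [pull] evaluates the left factor at a vertex. Removing its coboundary from [phi] leaves [k u b],
   which no longer sees the first letter: a cocycle of order [n]. *)
pose pull w := if w is a :: u then (hk u).1 a else 1%g.
pose k w b := ((hk w).2 b * pull (rcons w b))%g.
pose phi' w := if w is a :: u then k (belast a u) (last a u) else 1%g.
have phi'E w b : phi' (rcons w b) = k w b.
  by case: w => //= a w; rewrite belast_rcons last_rcons.
have [g [psi gE]] := IH phi'.
exists (fun w => pull w * g (behead w))%g, psi => -[//|a u] b [su] Law.
have Lub : L (rcons u b) by apply: (@tree_catr [:: a]).
have Lu : L u by move: Lub; rewrite -cats1 => /tree_catl.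
have := gE u b su Lub; rewrite phi'E /k => kE.
have -> : phi (rcons (a :: u) b) = ((hk u).1 a * (hk u).2 b)%g by apply: hkE.
rewrite /= invgM !mulgA -[(_ * g u * psi b)%g]mulgA.
rewrite -[(_ * (g u * psi b) * _)%g]mulgA -kE; case: (rcons u b) => //= [|x v].
  by rewrite invg1 !mulg1.
by rewrite -!mulgA mulgV mulg1.
Qed.

(** Induction on the number [k] of letters in front of a common suffix [u]. By induction the value
    depends only on the letter just before [u]; two such letters sharing a right letter [b] are
    compared after an edge labelled [b], where [rcons u b] is common and [beta b] is injective. *)
Lemma tree_descent (Z O : Type) n (J : seq A -> Z -> O) (D : seq A -> set Z)
    (tau : A -> Z -> Z) (beta : A -> O -> O) :
  (forall b, injective (beta b)) ->
  (forall u a z, D u z -> D (a :: u) z) ->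
  (forall u b z, D u z -> D (rcons u b) (tau b z)) ->
  (forall a u b z, size u = n -> L (a :: rcons u b) -> D u z ->
    J (rcons u b) (tau b z) = beta b (J (a :: u) z)) ->
  forall w w' z, size w = n.+1 -> size w' = n.+1 -> L w -> L w' ->
    D [::] z -> J w z = J w' z.
Proof.
move=> beta_inj Dl Dr JE w w' z sw sw' Lw Lw' Dz.
have Dcat v u y : D u y -> D (v ++ u) y.
  by elim: v => //= a v IH /IH; apply: Dl.
suff main k : forall u v v' z, size v = k -> size v' = k ->
    k + size u = n.+1 -> L (v ++ u) -> L (v' ++ u) -> D u z ->
    J (v ++ u) z = J (v' ++ u) z.
  by rewrite -[w]cats0 -[w']cats0; apply: (main n.+1); rewrite ?cats0 ?addn0.
elim: k => [u v v' y /size0nil-> /size0nil->//|k IH u v v' y].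
case/lastP: v => // v a; case/lastP: v' => // v' a'.
rewrite !size_rcons !cat_rcons => -[sv] [sv'] sk Lv Lv' Dy.
have Lau x t : L (t ++ x :: u) -> L (x :: u) by apply: tree_catr.
have pick x : exists t, L (x :: u) -> size t = k /\ L (t ++ x :: u).
  have [Lx|//] := pselect (L (x :: u)); last by exists [::].
  by have [t st Lt] := tree_extl_size k Lx; exists t.
have [t tE] := choice pick.
pose h x := J (t x ++ x :: u) y.
have hE x s : size s = k -> L (s ++ x :: u) -> J (s ++ x :: u) y = h x.
  move=> ss Ls; have [st Lt] := tE _ (Lau _ _ Ls).
  by apply: IH => //=; [rewrite -sk addSnnS | apply: Dl].
rewrite (hE a) // (hE a') //; apply: (tree_connected (u := u)); last first.
- exact: Lau Lv'.
- exact: Lau Lv.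
- move=> x x' b Lx Lx'.
  have step c : L (c :: rcons u b) -> exists s, [/\ size s = k,
    L (s ++ rcons u b) &
      beta b (h c) = J (s ++ rcons u b) (tau b y)].
    move=> Lc; have [s ss Ls] := tree_extl_size k Lc.
    have Ls' : L (s ++ c :: u).
      by move: Ls; rewrite -rcons_cons -rcons_cat -cats1 => /tree_catl.
    exists (behead (rcons s c)); rewrite -(hE c s) //.
    have sE : s ++ c :: u = rcons s c ++ u by rewrite cat_rcons.
    move: Ls Ls'; rewrite -cat_rcons sE; case E: (rcons s c) => [|d s'] /=.
      by case: (s) E.
    have ss' : size s' = k by have := congr1 size E;
      rewrite size_rcons /= ss => -[].
    move=> Ls Ls'; split => //.
      exact: (@tree_catr [:: d]).
    rewrite -rcons_cat (JE d) ?rcons_cat //.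
      by rewrite size_cat ss'; move: sk; rewrite addSn => -[].
    exact: Dcat.
  have [s [ss Ls sE]] := step _ Lx; have [s' [ss' Ls' sE']] := step _ Lx'.
  apply: (@beta_inj b); rewrite sE sE'; apply: IH => //.
    by rewrite size_rcons -sk addSnnS.
  exact: Dr.
- by move: Lv; rewrite -cat_rcons => /tree_catr.
Qed.

End Fixed.
End TreeLanguages.

(** * Free groups and groups of bijections *)

Section PermExtension.

(** A point [x] is added to the domain by composing with the transposition of [s x] and [f x], which
    by injectivity leaves the other values alone. *)
Lemma perm_extension (T : finType) (D : {set T}) (f : T -> T) :
  {in D &, injective f} -> exists s : {perm T}, {in D, s =1 f}.
Proof.
have [n] := ubnP #|D|; elim: n D => // n IH D.
have [->|[x xD]] := set_0Vmem D; first by exists 1%g => x; rewrite inE.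
rewrite (cardsD1 x) xD ltnS => Dn fI.
have [|s sf] := IH _ Dn.
  by move=> y z /setD1P[_ yD] /setD1P[_ zD]; apply: fI.
exists (s * tperm (s x) (f x))%g => y yD; rewrite permM.
have [->|yx] := eqVneq y x; first by rewrite tpermL.
have yDx : y \in (D :\ x)%SET by rewrite !inE yx.
rewrite tpermD; first exact: sf.
  by rewrite (inj_eq perm_inj) eq_sym.
by rewrite sf //; apply: contra_neq yx => /fI->.
Qed.

End PermExtension.

Record self_bij (O : Type) := SelfBij {
  self_fun :> O -> O;
  self_inv : O -> O;
  self_funK : cancel self_fun self_inv;
  self_invK : cancel self_inv self_fun
}.

HB.instance Definition _ (O : Type) := gen_eqMixin (self_bij O).
HB.instance Definition _ (O : Type) := gen_choiceMixin (self_bij O).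

Section SelfBijGroup.
Variable O : Type.
Implicit Types f g : self_bij O.

Lemma self_bijP f g : self_fun f =1 self_fun g -> f = g.
Proof.
case: f g => [f f' fK f'K] [g g' gK g'K] /= /funext fg; subst g.
have e : f' = g' by apply/funext => x; rewrite -{1}[x]g'K fK.
by subst g'; congr SelfBij; apply: Prop_irrelevance.
Qed.

(* Bijections act on the right: [self_mul f g] is "first f, then g". *)
Definition self_one := @SelfBij O id id (frefl _) (frefl _).
Definition self_mul f g :=
  SelfBij (can_comp (self_funK g) (self_funK f))
          (can_comp (self_invK f) (self_invK g)).
Definition self_opp f := SelfBij (self_invK f) (self_funK f).

Lemma self_mulA : associative self_mul.
Proof. by move=> f g h; apply: self_bijP. Qed.
Lemma self_mul1g : left_id self_one self_mul.
Proof. by move=> f; apply: self_bijP. Qed.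
Lemma self_mulg1 : right_id self_one self_mul.
Proof. by move=> f; apply: self_bijP. Qed.
Lemma self_mulVg : left_inverse self_one self_opp self_mul.
Proof. by move=> f; apply: self_bijP => x /=; apply: self_invK. Qed.
Lemma self_mulgV : right_inverse self_one self_opp self_mul.
Proof. by move=> f; apply: self_bijP => x /=; apply: self_funK. Qed.

HB.instance Definition _ := isGroup.Build (self_bij O)
  self_mulA self_mul1g self_mulg1 self_mulVg self_mulgV.

Lemma self_funM f g x : (f * g)%g x = g (f x).
Proof. by []. Qed.

End SelfBijGroup.

Section FreeGroup.
Local Open Scope group_scope.
Variable A : choiceType.

Lemma fg_lift1 (G : groupType) (f : A -> G) : fg_lift f 1 = 1.
Proof. by rewrite /fg_lift big_nil. Qed.

Lemma fg_liftV (G : groupType) (f : A ->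
  G) u : fg_lift f u^-1 = (fg_lift f u)^-1.
Proof. by apply: (mulgI (fg_lift f u)); rewrite -fg_liftM !mulgV fg_lift1. Qed.

Lemma fg_prod_val (s : seq (A * bool)) :
  fg_word (\prod_(x <- s) (if x.2 then (fg_gen x.1)^-1 else fg_gen x.1)) =
  foldr (@fg_push A) [::] s.
Proof.
elim: s => [|[a e] s IH]; first by rewrite big_nil.
by rewrite big_cons /= -IH; case: e.
Qed.

Lemma fg_prod_gen (u : free_group A) :
  \prod_(x <- u) (if x.2 then (fg_gen x.1)^-1 else fg_gen x.1) = u.
Proof.
by apply: val_inj; rewrite /= fg_prod_val foldr_push_id //; apply: fg_reduced.
Qed.

Lemma word_in_fg_val (w : seq A) :
  fg_word (word_in_fg w) = [seq (a, false) | a <- w].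
Proof.
rewrite /word_in_fg; elim: w => [|a w IH]; first by rewrite big_nil.
by rewrite big_cons /= IH; case: w {IH} => [|b w] //=;
  case: eqP => // /(congr1 snd).
Qed.

Lemma word_in_fg_nil : word_in_fg [::] = 1 :> free_group A.
Proof. by rewrite /word_in_fg big_nil. Qed.

Lemma word_in_fg_cat (v w : seq A) :
  word_in_fg (v ++ w) = word_in_fg v * word_in_fg w.
Proof. by rewrite /word_in_fg big_cat. Qed.

Lemma word_in_fg_rcons (w : seq A) a :
  word_in_fg (rcons w a) = word_in_fg w * fg_gen a.
Proof. by rewrite -cats1 word_in_fg_cat /word_in_fg big_seq1. Qed.

Lemma fg_lift_word (G : groupType) (f : A -> G) (w : seq A) :
  fg_lift f (word_in_fg w) = \prod_(a <- w) f a.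
Proof.
elim: w => [|a w IH]; first by rewrite word_in_fg_nil fg_lift1 big_nil.
by rewrite -cat1s word_in_fg_cat fg_liftM IH big_cons /word_in_fg big_seq1
  fg_lift_gen.
Qed.

End FreeGroup.

(** * Bifix codes *)

Section BifixCodes.
Local Open Scope nat_scope.
Variables (A : finType) (X : set (seq A)).
Hypothesis bX : bifix_code X.
Implicit Types (u v w x y p t : seq A) (a b : A).

Definition prefix_free u : Prop := forall y, X y -> ~~ prefix y u.

Lemma prefix_rconsP y p b : prefix y (rcons p b) -> prefix y p \/ y = rcons p b.
Proof.
move=> /prefixP[s]; case/lastP: s => [|s c]; first by rewrite cats0; right.
by rewrite -rcons_cat => /rcons_inj[-> _]; left; apply: prefix_prefix.
Qed.

Lemma prefix_free_nil : prefix_free [::].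
Proof.
by move=> y Xy; rewrite prefixs0; apply/eqP => y0; case: bX; rewrite -y0.
Qed.

Lemma prefix_free_rcons p b :
  prefix_free p -> ~ X (rcons p b) -> prefix_free (rcons p b).
Proof.
move=> pf nX y Xy; apply/negP => /prefix_rconsP[yp|yb];
  last by rewrite yb in Xy.
by move: (pf y Xy); rewrite yp.
Qed.

Lemma prefix_free_prefix p t : prefix_free (p ++ t) -> prefix_free p.
Proof. by move=> pf y Xy; apply: contra (pf y Xy) => /prefix_catl. Qed.

Lemma suffix_comparable s1 s2 t : suffix s1 t -> suffix s2 t ->
  suffix s1 s2 \/ suffix s2 s1.
Proof.
wlog s12 : s1 s2 / size s1 <= size s2 => [wl|] t1 t2.
  have [|/ltnW] := leqP (size s1) (size s2); first by move=> /wl; apply.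
  by move=> /wl h; case: (h t2 t1); [right | left].
have := size_suffix t2; left; move: t1 t2; rewrite !suffixE => /eqP t1 /eqP t2.
by rewrite -[X in drop _ X]t2 drop_drop addnC addnBA // subnK // t1.
Qed.

Lemma bifix_suffix_eq x y t : X x -> X y -> suffix x t -> suffix y t -> x = y.
Proof.
move=> Xx Xy xt yt; case: bX => _ _ sX.
by case: (suffix_comparable xt yt) => [/(sX _ _ Xx Xy)|/(sX _ _ Xy Xx)].
Qed.

(* Reading a letter extends the unfinished last factor of the greedy
   factorization over X, and closes it when it lands in X. *)
Definition parse_next b p : seq A :=
  if `[< X (rcons p b) >] then [::] else rcons p b.

Lemma size_parse_next b p : size (parse_next b p) <= (size p).+1.
Proof. by rewrite /parse_next; case: ifP => // _; rewrite size_rcons. Qed.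

(** Two code words closing at the same position of a word are both suffixes of it, hence equal. So
    reading a letter is injective on the tails of [u], which is what lets it extend to a
    bijection. *)
Lemma parse_next_inj u b p q : suffix p u -> suffix q u ->
  parse_next b p = parse_next b q -> p = q.
Proof.
move=> pu qu; rewrite /parse_next.
have pub : suffix (rcons p b) (rcons u b) by rewrite suffix_rcons eqxx.
have qub : suffix (rcons q b) (rcons u b) by rewrite suffix_rcons eqxx.
case: asboolP => Xp; case: asboolP => Xq.
- by have /rcons_inj[] := bifix_suffix_eq Xp Xq pub qub.
- by move=> /(congr1 size); rewrite size_rcons.
- by move=> /(congr1 size); rewrite size_rcons.
- by move=> /rcons_inj[].
Qed.

Lemma suffix_parse_next u b p :
  suffix p u -> suffix (parse_next b p) (rcons u b).
Proof.
rewrite /parse_next; case: ifP => _; first by rewrite suffix0s.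
by rewrite suffix_rcons eqxx.
Qed.

Lemma prefix_free_next b p : prefix_free p -> prefix_free (parse_next b p).
Proof.
rewrite /parse_next; case: asboolP => Xp pf; first exact: prefix_free_nil.
exact: prefix_free_rcons.
Qed.

(** * Greedy parsing with weights in a group *)

Section Weighted.
Local Open Scope group_scope.
Variables (G : groupType) (f : seq A -> G).

Definition parse_weight b p : G :=
  if `[< X (rcons p b) >] then f (rcons p b) else 1.

Definition parse_step b (z : seq A * G) : seq A * G :=
  (parse_next b z.1, z.2 * parse_weight b z.1).

Definition parse_run t (z : seq A * G) := foldl (fun z b => parse_step b z) z t.

Definition parse_dom u : set (seq A * G) :=
  [set z | suffix z.1 u /\ prefix_free z.1].

Lemma parse_dom_rcons u b z :
  parse_dom u z -> parse_dom (rcons u b) (parse_step b z).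
Proof.
by case=> zu zf; split; [exact: suffix_parse_next | exact: prefix_free_next].
Qed.

Lemma parse_runP t : exists xs p, [/\ t = flatten xs ++ p,
  forall x, x \in xs -> X x, prefix_free p &
  forall g, parse_run t ([::], g) = (p, g * \prod_(x <- xs) f x)].
Proof.
elim/last_ind: t => [|t b [xs [p [tE Xxs pf run]]]].
  exists [::], [::]; split => //; first exact: prefix_free_nil.
  by move=> g; rewrite big_nil mulg1.
have [Xp|nXp] := pselect (X (rcons p b)).
  exists (rcons xs (rcons p b)), [::]; split.
  - by rewrite cats0 flatten_rcons tE rcons_cat.
  - by move=> x; rewrite mem_rcons inE => /predU1P[->|/Xxs].
  - exact: prefix_free_nil.
  - move=> g; rewrite /parse_run foldl_rcons -/(parse_run _ _) run /parse_step.
    rewrite /parse_next /parse_weight /=; case: asboolP => //= _.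
    by rewrite -[rcons xs _]cats1 big_cat big_seq1 mulgA.
exists xs, (rcons p b); split => //.
- by rewrite tE rcons_cat.
- exact: prefix_free_rcons.
- move=> g; rewrite /parse_run foldl_rcons -/(parse_run _ _) run /parse_step.
  rewrite /parse_next /parse_weight /=; case: asboolP => //= _.
  by rewrite mulg1.
Qed.

End Weighted.

(** * From the weighted parsing to a group action *)

Section Action.
Local Open Scope group_scope.
Variable L : set (seq A).
Hypothesis tL : tree_language L.
Variables (G : groupType) (f : seq A -> G) (n : nat).

(** Tails of length at most [n.+1] form a finite type, where a partial injection extends to a
    permutation; the tails of a vertex [u] of length [n] grow by at most one letter. *)
Let O : Type := (n.+1.-bseq A * G)%type.
Let emb (z : seq A * G) : O := (insub_bseq n.+1 z.1, z.2).

Lemma insub_bseqK (T : Type) m (s : seq T) : (size s <= m)%N ->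
  insub_bseq m s = s :> seq T.
Proof. by move=> sm; rewrite /insub_bseq insubdK. Qed.

Let emb_inj z z' : (size z.1 <= n.+1)%N -> (size z'.1 <= n.+1)%N ->
  emb z = emb z' -> z = z'.
Proof.
case: z z' => [p g] [p' g'] /= sp sp' [/(congr1 (@bseqval _ _))].
by rewrite !insub_bseqK // => -> ->.
Qed.

Lemma parse_step_extension u b : size u = n ->
  exists phi : self_bij O, forall z, @parse_dom G u z ->
    phi (emb z) = emb (parse_step f b z).
Proof.
move=> su.
pose step (p : n.+1.-bseq A) := insub_bseq n.+1 (parse_next b p).
pose D := finset (fun p : n.+1.-bseq A => suffix p u).
have sD p : suffix p u -> (size p <= n)%N.
  by move=> pu; rewrite -su size_suffix.
have stepI : {in D &, injective step}.
  move=> p q; rewrite !inE => pu qu /(congr1 (@bseqval _ _)).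
  have next_size r : suffix r u -> (size (parse_next b r) <= n.+1)%N.
    by move=> /sD sr; apply: leq_trans (size_parse_next b r) _.
  rewrite !insub_bseqK ?next_size // => /(parse_next_inj pu qu).
  exact: val_inj.
have [s sE] := perm_extension stepI.
pose F (z : O) : O := (s z.1, z.2 * parse_weight f b z.1).
pose F' (z : O) : O := ((s^-1)%g z.1,
  z.2 * (parse_weight f b ((s^-1)%g z.1))^-1).
have FK : cancel F F' by move=> [p g]; rewrite /F /F' /= permK mulgK.
have F'K : cancel F' F by move=> [p g]; rewrite /F /F' /= permKV mulgVK.
exists (SelfBij FK F'K) => -[p g] [/= pu _].
have sp : (size p <= n)%N by apply: sD.
have pK : insub_bseq n.+1 p = p :> seq A by rewrite insub_bseqK // ltnW.
by rewrite /F /emb /= sE ?inE ?pK // /step pK.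
Qed.

(* The cocycle sending a word a u b to a bijection extending [parse_step] is
   trivialized by the tree condition; [j] is the fibre over the empty word,
   which does not depend on the vertex by connectedness. *)
Lemma bifix_action : exists (O : Type) (psi : A -> self_bij O) (j : G -> O),
  injective j /\ forall t, L t -> (size t <= n.+1)%N ->
  exists xs p, [/\ t = flatten xs ++ p, forall x, x \in xs -> X x,
    prefix_free p &
    forall g g', (\prod_(a <- t) psi a) (j g) = j g' <->
                 p = [::] /\ g' = g * \prod_(x <- xs) f x].
Proof.
have extension (ub : seq A * A) : exists phi : self_bij O, size ub.1 = n ->
    forall z, parse_dom ub.1 z -> phi (emb z) = emb (parse_step f ub.2 z).
  case: ub => u b; have [su|nsu] := pselect (size u = n); last by exists 1.
  by have [h hE] := parse_step_extension b su; exists h.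
have [phi phiE] := choice extension.
pose phi' e := if e is _ :: c :: v then phi (belast c v, last c v) else 1.
have phi'E a u b : phi' (a :: rcons u b) = phi (u, b).
  by case: u => //= c u; rewrite belast_rcons last_rcons.
have [g [psi gE]] := tree_cocycle tL n.+1 phi'.
(* [g w] acts as a change of coordinates at the vertex [w], in which reading [b] becomes the same
   bijection [psi b] everywhere. *)
pose J w z := g w (emb z).
have JE a u b z : size u = n -> L (a :: rcons u b) -> @parse_dom G u z ->
    J (rcons u b) (parse_step f b z) = psi b (J (a :: u) z).
  move=> su Lu Dz; have := gE (a :: u) b (congr1 S su) Lu.
  rewrite rcons_cons phi'E /J => e;
    rewrite -(phiE (u, b) su) // e !self_funM /=.
  by rewrite self_invK.
have Jconst w w' h : size w = n.+1 -> size w' = n.+1 -> L w -> L w' ->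
    J w ([::], h) = J w' ([::], h).
  move=> sw sw' Lw Lw'.
  apply: (tree_descent tL (n := n) (J := J) (D := @parse_dom G)
    (tau := parse_step f) (beta := fun b => self_fun (psi b))) => //.
  - by move=> b; apply: can_inj (self_funK (psi b)).
  - by move=> u a z [zu zf]; split => //; apply: suffix_trans zu _;
    apply: suffix_cons.
  - by move=> u b z; apply: parse_dom_rcons.
  - by split; [apply: suffix0s | apply: prefix_free_nil].
have [w0 sw0] := tree_extl_size tL n.+1 (tree_nil tL).
rewrite cats0 => Lw0.
have J_inj w z z' : (size z.1 <= n.+1)%N -> (size z'.1 <= n.+1)%N ->
    J w z = J w z' -> z = z'.
  by move=> sz sz' /(can_inj (self_funK (g w))); apply: emb_inj.
exists O, psi, (fun h => J w0 ([::], h)); split.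
  by move=> h h' /J_inj => /(_ isT isT)[].
move=> t Lt st; have [xs [p [tE Xxs pf run]]] := parse_runP f t.
exists xs, p; split => // h h'.
have [v sv Lv] := tree_extl_size tL n.+1 Lt.
have Lv0 : L v by exact: (tree_catl tL Lv).
have main s : (size s <= n.+1)%N -> L (v ++ s) ->
    J (drop (size s) v ++ s) (parse_run f s ([::], h)) =
    (\prod_(a <- s) psi a) (J v ([::], h)).
  elim/last_ind: s => [|s b IH]; first by rewrite drop0 cats0 big_nil.
  rewrite size_rcons => ss; rewrite -rcons_cat => Lsb.
  have Ls : L (v ++ s) by apply: (@tree_catl _ _ tL _ [:: b]); rewrite cats1.
  rewrite -[rcons s b in RHS]cats1 big_cat big_seq1 self_funM -IH //;
    last exact: ltnW.
  rewrite (@drop_nth _ b (size s) v) ?sv // -rcons_cat /parse_run foldl_rcons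
    -/(parse_run _ _ _).
  have [ys [q [sE _ qf ->]]] := parse_runP f s.
  apply: JE.
  - by rewrite size_cat size_drop sv subSS subnK.
  - rewrite -rcons_cons -cat_cons -drop_nth ?sv //.
    apply: (tree_catr tL (u := take (size s) v)).
    by rewrite -rcons_cat catA cat_take_drop.
  - split => //=; rewrite sE catA; apply: suffix_suffix.
have {}main := main t st Lv.
rewrite (Jconst w0 v) // -main run (Jconst w0 (drop (size t) v ++ t)) //;
  last first.
  by apply: (tree_catr tL (u := take (size t) v)); rewrite catA cat_take_drop.
  by rewrite size_cat size_drop sv subnK.
have sp : (size p <= n.+1)%N.
  by apply: leq_trans st; rewrite tE size_cat leq_addl.
split; first by move=> /J_inj /= => /(_ sp isT)[-> ->].
by move=> [-> ->].
Qed.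

End Action.
End BifixCodes.

(** * Freeness, saturation and cosets *)

Section BifixBases.
Local Open Scope group_scope.
Variables (A : finType) (L X : set (seq A)).
Hypotheses (tL : tree_language L) (bX : bifix_code X).
Implicit Types (u v w x y p t : seq A) (a b : A).

Let B : set (free_group A) := @word_in_fg A @` X.
Let lift := fg_lift (val : B -> free_group A).
Let K : set (free_group A) := range lift.

Definition tails w : set (seq A) := [set u | suffix u w /\ prefix_free X u].

Lemma flatten_prefix_free s p x : X x -> (forall y, y \in s -> X y) ->
  prefix_free X p -> x = flatten s ++ p -> s = [:: x] /\ p = [::].
Proof.
case: s => [|y s] Xx Xs pf /=.
  by move=> xp; have := pf x Xx; rewrite xp prefix_refl.
have Xy : X y by apply: Xs; rewrite mem_head.
rewrite -catA => xE; have yx : y = x.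
  by case: bX => _ pX _; apply: pX => //; rewrite xE prefix_prefix.
have : size (flatten s ++ p) = 0%N.
  by apply/eqP; rewrite -(eqn_add2l (size y)) -size_cat -xE yx addn0.
move=> /size0nil; case: s {xE} Xs => [|z s] Xs /=; first by rewrite yx => ->.
move=> /(congr1 size) /=; rewrite -catA; case: z Xs => // Xs _.
by case: bX => nX _ _; case: nX; apply: Xs; rewrite !inE eqxx orbT.
Qed.

Lemma gens_action (x : seq A) : X x -> exists b : B, val b = word_in_fg x.
Proof.
move=> Xx; have Bx : B (word_in_fg x) by exists x.
by exists (SigSub (mem_set Bx)).
Qed.

Section Finite.
Hypotheses (XL : X `<=` L) (finX : finite_set X).

Lemma finite_code_bound : exists N, forall x, X x -> (size x <= N)%N.
Proof.
have /finite_seqP[s Xs] := finX.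
exists (\max_(x <- s) size x)%N => x; rewrite Xs /= => xs.
by rewrite (big_rem x) //= leq_maxl.
Qed.

Lemma bifix_basis_action n : exists (O : Type) (psi : A -> self_bij O)
    (j : free_group B -> O),
  [/\ injective j,
    forall (y g : free_group B), j (g * y) = fg_lift psi (lift y) (j g)
  & forall t, L t -> (size t <= n.+1)%N -> forall g g',
    fg_lift psi (word_in_fg t) (j g) = j g' -> star X t].
Proof.
have [N XN] := finite_code_bound.
pose f x : free_group B := xget 1 [set y | exists2 b : B,
  val b = word_in_fg x & y = fg_gen b].
have fE (b : B) x : val b = word_in_fg x -> f x = fg_gen b.
  move=> bx; rewrite /f; case: xgetP => [y _ [b' b'x ->]|/(_ (fg_gen b))];
    last first.
    by case; exists b.
  by congr fg_gen; apply: val_inj; rewrite b'x bx.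
(* The bound [maxn N n] lets the action read every code word as well as every test word [t]. *)
have [O [psi [j [j_inj jE]]]] := bifix_action bX tL f (maxn N n).
exists O, psi, j; split=> //; last first.
  move=> t Lt st g g'; rewrite fg_lift_word.
  have [|xs [p [-> Xxs _ /(_ g g') pE]]] := jE t Lt.
    by apply: leq_trans st _; rewrite ltnS leq_maxr.
  by move=> /pE[-> _]; exists xs => //=; rewrite cats0.
have jgen (b : B) g : j (g * fg_gen b) = fg_lift psi (val b) (j g).
  have [x Xx xb] := set_valP b.
  have [|xs [p [xE Xxs pf /(_ g (g * fg_gen b)) pE]]] := jE x (XL Xx).
    by apply: leq_trans (XN x Xx) _; rewrite leqW // leq_maxl.
  have [xsE p0] := flatten_prefix_free Xx Xxs pf xE.
  rewrite -xb fg_lift_word; apply/esym/pE; split => //.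
  by rewrite xsE big_seq1 (fE b).
have jgenV (b : B) g : j (g * (fg_gen b)^-1) = (fg_lift psi (val b))^-1 (j g).
  apply: (can_inj (self_funK (fg_lift psi (val b)))).
  by rewrite -jgen mulgVK -self_funM mulVg.
move=> y; rewrite -{1}[y]fg_prod_gen /lift /fg_lift -/(fg_lift psi _).
elim: (fg_word y) => [|[b e] s IH] g.
  by rewrite !big_nil mulg1 fg_lift1.
rewrite !big_cons mulgA IH fg_liftM self_funM /=; congr (fg_lift psi _ _).
by case: e; rewrite ?fg_liftV ?jgen ?jgenV.
Qed.

(** The element [lift y] moves [j 1] to [j y], so it determines [y]. *)
Theorem bifix_free : injective lift.
Proof.
move=> y z yz; have [O [psi [j [j_inj jE _]]]] := bifix_basis_action 0.
by apply: j_inj; rewrite -[y]mul1g -[z]mul1g !jE yz.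
Qed.

(** A word in [K] moves [j 1] to some [j y], back into the fibre over the empty tail: its greedy
    parsing leaves no remainder. *)
Theorem bifix_saturated t : L t -> K (word_in_fg t) -> star X t.
Proof.
move=> Lt [y _ yt]; have [O [psi [j [j_inj jE jS]]]] := bifix_basis_action
  (size t).
by apply: (jS t Lt (leqnSn _) 1 y); rewrite -yt -jE mul1g.
Qed.

End Finite.

Lemma span1 : K 1.
Proof. by exists 1 => //; rewrite /lift fg_lift1. Qed.

Lemma spanM g h : K g -> K h -> K (g * h).
Proof. by move=> [y _ <-] [z _ <-]; exists (y * z) => //;
  rewrite /lift fg_liftM. Qed.

Lemma spanV g : K g -> K g^-1.
Proof. by move=> [y _ <-]; exists y^-1 => //; rewrite /lift fg_liftV. Qed.

Lemma span_subgroup : subgroup K.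
Proof. by split; [apply: span1 | apply: spanM | apply: spanV]. Qed.

Lemma span_code x : X x -> K (word_in_fg x).
Proof.
by move=> /gens_action[b bx]; exists (fg_gen b) => //;
  rewrite /lift fg_lift_gen.
Qed.

Let coset (g : free_group A) : set (free_group A) := [set h * g | h in K].

Lemma coset_eqP g h : coset g = coset h <-> K (g * h^-1).
Proof.
split=> [gh|Kgh].
  have : coset g g by exists 1; rewrite ?mul1g //; apply: span1.
  by rewrite gh => -[k Kk <-]; rewrite mulgK.
apply/seteqP; split => _ [k Kk <-].
  exists (k * (g * h^-1)); first exact: spanM.
  by rewrite !mulgA mulgVK.
exists (k * (g * h^-1)^-1); first by apply: spanM => //; apply: spanV.
by rewrite invgM invgK !mulgA mulgVK.
Qed.

(** Two tails of [w] are comparable, say [u = t ++ v]. Equal cosets put [t] in [K], hence in the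
    star of [X] by saturation; a nonempty [t] would give [u] a prefix in [X]. *)
Lemma tails_coset_inj w : finite_set X -> X `<=` L -> L w ->
  {in tails w &, injective (fun u => coset (word_in_fg u))}.
Proof.
move=> finX XL Lw.
suff main u v : tails w u -> suffix v u ->
  coset (word_in_fg u) = coset (word_in_fg v) -> u = v.
  move=> u v /set_mem tu /set_mem tv uv.
  have [vu|uv'] := suffix_comparable (proj1 tv) (proj1 tu).
    exact: main.
  by apply/esym; apply: main.
move=> [/suffixP[s wE] uf] /suffixP[t uE] /coset_eqP.
rewrite uE word_in_fg_cat mulgK => /(bifix_saturated XL finX).
have /[swap]/[apply] : L t.
  apply: (@tree_catl _ _ tL _ v); rewrite -uE.
  by apply: (@tree_catr _ _ tL s); rewrite -wE.
case=> -[_ <- //|x xs] /= Xs tE.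
have Xx : X x by apply: Xs; rewrite mem_head.
by have := uf x Xx; rewrite uE -tE -catA prefix_prefix.
Qed.

(* The union of the cosets K u, u a tail of w, does not depend on the vertex w
   of the Rauzy graph, hence is invariant under right multiplication. *)
Lemma tails_cover n : (forall w, L w -> (n <= size w)%N ->
    (exists2 x, X x & prefix x w) /\ (exists2 x, X x & suffix x w)) ->
  forall w, L w -> size w = n.+1 ->
  right_cosets K = (fun u => coset (word_in_fg u)) @` tails w.
Proof.
move=> Xn.
pose R (w : seq A) (_ : unit) : set (free_group A) :=
  [set g | exists2 u, tails w u & coset (word_in_fg u) g].
have Rnil w g : K g -> R w tt g.
  move=> Kg; exists [::]; first by split;
    [exact: suffix0s | exact: prefix_free_nil].
  by exists g; rewrite ?word_in_fg_nil ?mulg1.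
have tails_code u b p : X (rcons p b) -> suffix p u -> tails u p.
  move=> Xp pu; split => // y Xy; apply/negP => yp; case: bX => _ pX _.
  have e := pX _ _ Xy Xp (prefix_trans yp (prefix_rcons p b)).
  by have := size_prefix yp; rewrite e size_rcons ltnn.
have RE a u b : size u = n -> L (a :: rcons u b) ->
    R (rcons u b) tt = [set g | R (a :: u) tt (g * (fg_gen b)^-1)].
  move=> su Laub.
  have Lau : L (a :: u) by apply: (@tree_catl _ _ tL _ [:: b]); rewrite cats1.
  have Lub : L (rcons u b) by apply: (@tree_catr _ _ tL [:: a]).
  have nub : (n <= size (rcons u b))%N by rewrite size_rcons su.
  apply/seteqP; split => g [q [qs qf] [h Kh hE]].
    case/lastP: q qs qf hE => [_ _|q c].
      rewrite word_in_fg_nil mulg1 => <-.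
      (* Here the coset is [K], which is also [K x] for a code word [x] ending [rcons u b]; deleting
         the last letter of [x] gives the required tail of [a :: u]. *)
      have [_ [x Xx]] := Xn _ Lub nub.
      case/lastP: x Xx => [|p c] Xx; first by case: bX.
      rewrite suffix_rcons => /andP[/eqP cb pu]; subst c.
      exists p; first by apply: (tails_code _ b) => //;
        apply: suffix_trans pu (suffix_cons _ _).
      exists (h * (word_in_fg (rcons p b))^-1).
        by apply: spanM => //; apply/spanV/span_code.
      by rewrite word_in_fg_rcons invgM !mulgA mulgVK.
    rewrite suffix_rcons => /andP[/eqP cb qu] qf; subst c.
    rewrite word_in_fg_rcons => <-; exists q.
      split; first by apply: suffix_trans qu (suffix_cons _ _).
      by apply: (@prefix_free_prefix _ _ _ [:: b]); rewrite cats1.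
    by exists h => //; rewrite !mulgA mulgK.
  have {}hE : g = h * word_in_fg (rcons q b).
    by rewrite word_in_fg_rcons mulgA hE mulgVK.
  have [Xq|nXq] := pselect (X (rcons q b)).
    by apply: Rnil; rewrite hE; apply: spanM => //; apply: span_code.
  exists (rcons q b); last by exists h.
  split; last exact: prefix_free_rcons.
  rewrite suffix_rcons eqxx /=.
  (* If [q] were the whole of [a :: u], that long word would have no prefix in [X]; hence [q] is a
     suffix of [u]. *)
  have [[x Xx xau] _] := Xn _ Lau (leqW (eq_leq (esym su))).
  case/suffixP: qs => -[/= aE|c s [_ ->]]; last exact: suffix_suffix.
  by have := qf x Xx; rewrite -aE xau.
have Rconst w w' : L w -> L w' -> size w = n.+1 -> size w' = n.+1 ->
    R w tt = R w' tt.
  move=> Lw Lw' sw sw'.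
  apply: (tree_descent tL (n := n) (J := R) (D := fun=> setT) (tau := fun _ =>
    id)
    (beta := fun b S => [set g | S (g * (fg_gen b)^-1)])) => //.
    move=> b S T ST; apply/funext => g.
    by have := congr1 (fun U => U (g * fg_gen b)) ST; rewrite /= mulgK.
  by move=> a u b [] su Lu _; apply: RE.
move=> w Lw sw.
(* An edge labelled [b] joins two vertices with the same [R], so the equivariance [RE] becomes
   invariance under right multiplication by [b]. *)
have Rgen b g : R w tt g <-> R w tt (g * (fg_gen b)^-1).
  have [v sv Lvb] := tree_extl_size tL n.+1 (tree_letter tL b).
  case: v sv Lvb => // a u [su]; rewrite cats1 => Laub.
  have -> : R w tt = R (a :: u) tt.
    apply: Rconst => //=; last by rewrite su.
    by apply: (@tree_catl _ _ tL _ [:: b]); rewrite cats1.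
  rewrite -[X in _ <-> X]/([set g | R (a ::
    u) tt (g * (fg_gen b)^-1)] g) -RE //.
  rewrite (Rconst (a :: u) (rcons u b)) //= ?size_rcons ?su //.
    by apply: (@tree_catl _ _ tL _ [:: b]); rewrite cats1.
  exact: (@tree_catr _ _ tL [:: a]).
have RT g : R w tt g.
  suff main (s : seq (A * bool)) k : R w tt k ->
      R w tt (k * \prod_(x <- s) (if x.2 then (fg_gen x.1)^-1 else fg_gen x.1)).
    by rewrite -[g]fg_prod_gen -[X in R w tt X]mul1g; apply/main/Rnil/span1.
  elim: s k => [|[b e] s IH] k Rk; first by rewrite big_nil mulg1.
  rewrite big_cons mulgA; apply: IH; case: e => /=; first exact: (Rgen b k).1.
  by apply/(Rgen b); rewrite mulgK.
apply/seteqP; split => [_ [g _ <-]|_ [u tu <-]]; last by exists (word_in_fg u).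
have [u tu [k Kk kE]] := RT g; exists u => //.
by apply/coset_eqP; rewrite -kE invgM mulgA mulgV mul1g; apply: spanV.
Qed.

End BifixBases.

(** * Degree and index *)

Section Degree.
Local Open Scope nat_scope.
Variables (A : finType) (X : set (seq A)).
Hypothesis bX : bifix_code X.
Implicit Types (u v w x y p t : seq A) (a b : A).

Lemma cat_right_inj s1 s2 t : s1 ++ t = s2 ++ t -> s1 = s2.
Proof.
move=> e; have := congr1 size e; rewrite !size_cat => /addIn s12.
by apply/eqP; move/eqP: e; rewrite eqseq_cat // => /andP[].
Qed.

Definition suffix_free v : Prop := forall y, X y -> ~~ suffix y v.

(** Code words are peeled off from the right: two last factors are suffixes of one word and agree,
    and a factor remaining on one side only would be a suffix of a suffix-free word. *)
Lemma suffix_free_star_eq v v' s s' : suffix_free v -> suffix_free v' ->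
  (forall x, x \in s -> X x) -> (forall x, x \in s' -> X x) ->
  v ++ flatten s = v' ++ flatten s' -> v = v' /\ flatten s = flatten s'.
Proof.
move=> vf vf'; elim/last_ind: s s' => [|s x IH] s'; case/lastP: s' => [|s' x'].
- by rewrite /= !cats0.
- move=> _ /(_ x') /=; rewrite mem_rcons mem_head => /(_ isT) Xx'.
  rewrite cats0 flatten_rcons catA => vE.
  by have := vf x' Xx'; rewrite vE suffix_suffix.
- move=> /(_ x) /=; rewrite mem_rcons mem_head => /(_ isT) Xx _.
  rewrite cats0 flatten_rcons catA => vE.
  by have := vf' x Xx; rewrite -vE suffix_suffix.
move=> Xs Xs'; have Xx : X x by apply: Xs; rewrite mem_rcons mem_head.
have Xx' : X x' by apply: Xs'; rewrite mem_rcons mem_head.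
rewrite !flatten_rcons !catA => vE.
have xx' : x = x'.
  apply: (bifix_suffix_eq bX Xx Xx' (t := (v ++ flatten s) ++ x)).
    exact: suffix_suffix.
  by rewrite vE suffix_suffix.
move: vE; rewrite xx' => /cat_right_inj /(IH s')[].
- by move=> y ys; apply: Xs; rewrite mem_rcons inE ys orbT.
- by move=> y ys; apply: Xs'; rewrite mem_rcons inE ys orbT.
- by move=> -> ->.
Qed.

Lemma suffix_free_split t : exists v s,
  [/\ t = v ++ flatten s, suffix_free v & forall x, x \in s -> X x].
Proof.
have [n] := ubnP (size t); elim: n t => // n IH t tn.
have [[x Xx /suffixP[t' tE]]|nt] := pselect (exists2 x, X x & suffix x t);
  last first.
  exists t, [::]; split; rewrite ?cats0 // => y Xy; apply/negP => yt.
  by case: nt; exists y.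
have x0 : 0 < size x by rewrite lt0n size_eq0; apply/eqP => x0; case: bX;
  rewrite -x0.
have [|v [s [t'E vf Xs]]] := IH t'.
  rewrite -ltnS; apply: leq_trans tn.
  by rewrite ltnS tE size_cat -[(size t').+1]addn1 leq_add2l.
exists v, (rcons s x); split => //; first by rewrite flatten_rcons catA -t'E.
by move=> y; rewrite mem_rcons inE => /predU1P[->|/Xs].
Qed.

(* A parse (v, x, u) of w is determined by its last component u, which can be
   any suffix of w without a prefix in X. *)
Lemma parses_tails w : (parses X w #= tails X w)%card.
Proof.
have -> : tails X w = (fun q => q.2) @` parses X w.
  apply/seteqP; split => [u [/suffixP[t wE] uf]|_ [[[v x] u] [wE _ _ uf] <-]];
    last first.
    by split => //=; rewrite wE catA suffix_suffix.
  have [v [s [tE vf Xs]]] := suffix_free_split t.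
  exists (v, flatten s, u) => //; split => //; last by exists s.
  by rewrite wE tE catA.
rewrite card_eq_sym; apply: inj_card_eq => -[[v x] u] [[v' x'] u'].
move=> /set_mem[wE [s Xs xE] vf _] /set_mem[wE' [s' Xs' xE'] vf' _] /= uu'.
move: wE'; rewrite wE -uu' -xE -xE' !catA => /cat_right_inj.
by move=> /(suffix_free_star_eq vf vf' Xs Xs')[-> ->].
Qed.

Fixpoint tail_count w : nat :=
  if w is _ :: w' then `[< prefix_free X w >] + tail_count w' else 1.

Lemma suffix_consP u a w : suffix u (a :: w) <-> u = a :: w \/ suffix u w.
Proof.
split=> [/suffixP[[|c s]] /=|[->|]].
- by move=> ->; left.
- by move=> [_ ->]; right; apply: suffix_suffix.
- exact: suffix_refl.
- by move=> /suffix_trans; apply; apply: suffix_cons.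
Qed.

Lemma card_tails w : (tails X w #= `I_(tail_count w))%card.
Proof.
elim: w => [|a w IH].
  have -> : tails X [::] = [set [::]].
    apply/seteqP; split => u /=; first by rewrite /tails /= suffixs0 => -[/eqP].
    by move=> ->; split; [apply: suffix_refl | apply: prefix_free_nil].
  by apply/eq_cardSP; exists [::] => //; rewrite setDv II0.
rewrite /=; case: asboolP => aw /=.
  apply/eq_cardSP; exists (a :: w); first by split; [apply: suffix_refl |].
  rewrite (_ : _ `\` _ = tails X w) //; apply/seteqP; split => u.
    by move=> [[/suffix_consP[->|uw] uf] /= nu].
  move=> [uw uf]; split; first by split => //; apply/suffix_consP; right.
  by move=> /= ue; have := size_suffix uw; rewrite ue ltnn.
rewrite (_ : tails X (a :: w) = tails X w) //; apply/seteqP; split => u [uw uf].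
  by case/suffix_consP: uw => [ue|uw]; [rewrite ue in uf | split].
by split => //; apply/suffix_consP; right.
Qed.

Lemma tail_count_prefix_free a w :
  prefix_free X (a :: w) -> tail_count (a :: w) = (tail_count w).+1.
Proof. by move=> aw /=; rewrite asboolT. Qed.

(** [parse_next] maps the tails of [w] injectively to those of [rcons w b]. *)
Lemma tail_count_rcons w b : tail_count w <= tail_count (rcons w b).
Proof.
have next_inj : {in tails X w &, injective (parse_next X b)}.
  by move=> p q /set_mem[pw _] /set_mem[qw _]; apply: parse_next_inj pw qw.
rewrite -card_le_II -(card_le_eql (card_tails w)) -(card_le_eqr (card_tails _)).
rewrite -(card_le_eql (inj_card_eq next_inj)); apply: subset_card_le.
move=> _ [p [pw pf] <-]; split; first exact: suffix_parse_next.
exact: prefix_free_next.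
Qed.

(** With no code word ending at [b], appending [b] keeps every tail a tail, and the empty tail comes
    in addition. *)
Lemma tail_count_suffix_free w b :
  suffix_free (rcons w b) -> tail_count (rcons w b) = (tail_count w).+1.
Proof.
move=> wf; apply/(@card_eq_II _ _).
rewrite -(card_eql (card_tails _)); apply/eq_cardSP; exists [::].
  by split; [apply: suffix0s | apply: prefix_free_nil].
rewrite -(card_eqr (card_tails w)).
have rcons_in : {in tails X w &, injective (rcons^~ b)}.
  by move=> p q _ _ /rcons_inj[].
rewrite -(card_eqr (inj_card_eq rcons_in)).
rewrite (_ : _ `\` _ = [set rcons p b | p in tails X w]) //.
apply/seteqP; split => [u [[uw uf] /=]|_ [p [pw pf] <-]].
  case/lastP: u uw uf => // p c; rewrite suffix_rcons => /andP[/eqP-> pw] pf _.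
  exists p => //; split => //.
  by apply: (@prefix_free_prefix _ _ _ [:: b]); rewrite cats1.
split; last by move=> /= /(congr1 size); rewrite size_rcons.
have pb : suffix (rcons p b) (rcons w b) by rewrite suffix_rcons eqxx.
split => //; apply: prefix_free_rcons => // Xp.
by have := wf _ Xp; rewrite pb.
Qed.

Lemma tail_count_infix v w : infix v w -> tail_count v <= tail_count w.
Proof.
move=> /infixP[s [t ->]].
have: tail_count v <= tail_count (v ++ t).
  elim/last_ind: t => [|t b IH]; first by rewrite cats0.
  by rewrite -rcons_cat; apply: leq_trans IH (tail_count_rcons _ _).
by elim: s => //= a s IH /IH /leq_trans; apply; apply: leq_addl.
Qed.

Lemma has_degreeP L d : has_degree L X d <->
  (exists2 w, L w & tail_count w = d) /\ (forall w, L w -> tail_count w <= d).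
Proof.
have pE w n : (parses X w #= `I_n)%card <-> tail_count w = n.
  rewrite (card_eql (parses_tails w)) (card_eql (card_tails w)).
  by split => [/card_eq_II|->].
have pL w n : (parses X w #<= `I_n)%card = (tail_count w <= n).
  by rewrite (card_le_eql (parses_tails w)) (card_le_eql (card_tails w))
    card_le_II.
split=> -[[w Lw wd] dm].
  by split; [exists w => //; apply/pE | move=> v /dm; rewrite pL].
by split; [exists w => //; apply/pE | move=> v /dm; rewrite pL].
Qed.

End Degree.

(** * Uniformly recurrent tree languages *)

Definition uniformly_recurrent (A : eqType) (L : set (seq A)) : Prop :=
  forall w, L w -> exists n, forall v, L v -> (n <= size v)%N -> infix w v.

Section FiniteIndexBasis.
Variables (A : finType) (L : set (seq A)).
Hypotheses (tL : tree_language L) (uL : uniformly_recurrent L).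
Implicit Types (u v w x y : seq A) (a b : A).

Lemma prefix_comparable v w t :
  prefix v t -> prefix w t -> prefix v w \/ prefix w v.
Proof. by rewrite -!suffix_rev; apply: suffix_comparable. Qed.

Section Code.
Variable X : set (seq A).
Hypotheses (bX : bifix_code X) (XL : X `<=` L) (finX : finite_set X).

Let B : set (free_group A) := @word_in_fg A @` X.
Let K : set (free_group A) := range (fg_lift (val : B -> free_group A)).

Lemma tail_count_le_index d w : has_index K d -> L w -> (tail_count X w <= d)%N.
Proof.
move=> Kd Lw.
rewrite -card_le_II -(card_le_eql (card_tails bX w)) -(card_le_eqr Kd).
rewrite -(card_le_eql (inj_card_eq (tails_coset_inj tL bX finX XL Lw))).
by apply: subset_card_le => _ [u _ <-]; exists (word_in_fg u).
Qed.

(** A long word without a prefix, or without a suffix, in [X] would have one more parse than the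
    word deprived of its first, or last, letter, although both attain the maximum [d]. This gives
    the hypothesis of [tails_cover], and maximality by comparing prefixes. *)
Lemma max_degree_index d : has_degree L X d ->
  maximal_bifix_code L X /\ has_index K d.
Proof.
move=> /(has_degreeP bX)[[w0 Lw0 w0d] dm].
have [n nE] := uL Lw0.
have long v : L v -> (n <= size v)%N -> tail_count X v = d.
  move=> Lv nv; apply/eqP; rewrite eqn_leq dm //= -w0d.
  by apply: tail_count_infix => //; apply: nE.
have Xn w : L w -> (n.+1 <= size w)%N ->
    (exists2 x, X x & prefix x w) /\ (exists2 x, X x & suffix x w).
  move=> Lw nw; split; apply: contrapT => no.
    case: w Lw nw no => // a w Law nw no.
    have wf : prefix_free X (a :: w).
      by move=> y Xy; apply/negP => yw; apply: no; exists y.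
    have Lw : L w by apply: (@tree_catr _ _ tL [:: a]).
    have := tail_count_prefix_free wf; rewrite (long w) // long //;
      last exact: ltnW.
    by move=> /n_Sn.
  case/lastP: w Lw nw no => // w b Lwb; rewrite size_rcons ltnS => nw no.
  have wf : suffix_free X (rcons w b).
    by move=> y Xy; apply/negP => yw; apply: no; exists y.
  have Lw : L w by apply: (@tree_catl _ _ tL _ [:: b]); rewrite cats1.
  have := tail_count_suffix_free bX wf; rewrite (long w) // long ?size_rcons //.
    by move=> /n_Sn.
  exact: leqW.
split.
  split => // Y bY YL XY; apply/seteqP; split => // y Yy.
  have [v sv Lv] := tree_extr_size tL n.+1 (YL _ Yy).
  have [|[x Xx xv] _] := Xn _ Lv; first by rewrite size_cat sv leq_addl.
  have Yx := XY _ Xx; have [_ pY _] := bY.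
  have [xy|yx] := prefix_comparable xv (prefix_prefix y v).
    by rewrite -(pY x y).
  by rewrite (pY y x).
have [w sw] := tree_extl_size tL n.+2 (tree_nil tL); rewrite cats0 => Lw.
rewrite /has_index (tails_cover tL bX Xn Lw sw).
rewrite (card_eql (inj_card_eq (tails_coset_inj tL bX finX XL Lw))).
by rewrite -(long w) ?sw ?leqW //; apply: card_tails.
Qed.

End Code.

Theorem tree_finite_index_basis : finite_index_basis_property L.
Proof.
move=> X d finX bX XL; split=> [[_ Xd]|[H [_ Hd [_ HE]]]].
  have [_ Kd] := max_degree_index bX XL finX Xd.
  exists (range (fg_lift (val : (@word_in_fg A @` X) -> free_group A))).
  split=> //; first exact: span_subgroup.
  by split => //; apply: bifix_free tL bX XL finX.
(* The index [d] bounds the numbers of parses, so their maximum [m] exists; [max_degree_index] then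
   gives index [m], whence [d = m]. *)
subst H; pose P m := `[< exists2 w, L w & tail_count X w = m >].
have P1 : exists m, P m.
  by exists (tail_count X [::]); apply/asboolP; exists [::] => //;
    apply: tree_nil tL.
have Pd m : P m -> (m <= d)%N.
  by move=> /asboolP[w Lw <-]; apply: tail_count_le_index.
case: (ex_maxnP P1 Pd) => m /asboolP[w Lw wm] mmax.
have Xm : has_degree L X m.
  apply/(has_degreeP bX); split; first by exists w.
  by move=> v Lv; apply: mmax; apply/asboolP; exists v.
have [Xmax Km] := max_degree_index bX XL finX Xm.
suff -> : d = m by [].
by apply/(@card_eq_II _ _); rewrite -(card_eql Hd).
Qed.

End FiniteIndexBasis.

(** * Interval exchanges *)

Section OrderedSums.
Local Open Scope ring_scope.
Variables (R : realType) (A : finType) (le : rel A) (lam : A -> R).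
Hypotheses (le_order : total_order le) (lam_gt0 : forall a, 0 < lam a).
Implicit Types a b c : A.

Let sigma a : R := \sum_(b | le b a) lam b.

Let le_total a b : le a b || le b a. Proof. by case: le_order. Qed.
Let le_anti a b : le a b -> le b a -> a = b.
Proof. by case: le_order => _ + _ ab ba; apply; rewrite ab ba. Qed.
Let le_trans a b c : le a b -> le b c -> le a c.
Proof. by case: le_order => _ _ +; apply. Qed.
Let le_refl a : le a a. Proof. by have := le_total a a; rewrite orbb. Qed.

Lemma osumE a : sigma a = lam a + \sum_(b | le b a && (b != a)) lam b.
Proof. by rewrite /sigma (bigD1 a). Qed.

Lemma osum_ge a : lam a <= sigma a.
Proof. by rewrite osumE lerDl; apply: sumr_ge0 => b _; apply: ltW. Qed.

Lemma osum_le_total a : sigma a <= \sum_b lam b.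
Proof.
rewrite (bigID (le^~ a)) /= lerDl; apply: sumr_ge0 => b _; exact: ltW.
Qed.

Lemma osum_lt a b : a != b -> le a b -> sigma a <= sigma b - lam b.
Proof.
move=> ab leab; rewrite [sigma b]osumE addrC addKr.
rewrite [X in _ <= X](bigID (le^~ a)) /= [X in _ <= X + _](_ : _ = sigma a).
  by rewrite lerDl; apply: sumr_ge0 => c _; apply: ltW.
apply: eq_bigl => c; case: (boolP (le c a)) => ca; rewrite ?andbF ?andbT //.
rewrite (le_trans ca leab) /=; apply: contraNneq ab => cb; subst c.
by apply/eqP; apply: le_anti.
Qed.

Lemma osum_pred a : sigma a - lam a = 0 \/
  exists c, [/\ c != a, le c a & sigma c = sigma a - lam a].
Proof.
have [[c0 c0a]|nc] := pselect (exists c, (c != a) && le c a); last first.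
  left; rewrite osumE addrC addKr big1 // => c /andP[ca c_a].
  by case: nc; exists c; rewrite ca c_a.
right; case: (@Order.TotalTheory.arg_maxP _ _ _ c0 (fun c =>
  (c != a) && le c a) sigma c0a).
move=> c /andP[ca lca] cmax; exists c; split=> //.
rewrite [sigma a]osumE addrC addKr; apply: eq_bigl => d.
apply/idP/andP => [dc|[da d_a]].
  split; first exact: le_trans dc lca.
  by apply: contraNneq ca => da; subst d; apply/eqP/le_anti.
case/orP: (le_total d c) => // cd; have [->//|dc] := eqVneq d c.
rewrite eq_sym in dc; have := osum_lt dc cd.
have := cmax d; rewrite d_a da => /(_ isT) /=; have := lam_gt0 d.
by move=> *; exfalso; lra.
Qed.

Lemma osum_total : (exists a : A, True) -> exists a, sigma a = \sum_b lam b.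
Proof.
move=> [a0 _]; case: (@Order.TotalTheory.arg_maxP _ _ _ a0 predT sigma isT) =>
  m _ mmax.
exists m; apply: eq_bigl => c; case/orP: (le_total c m) => // mc.
have [->|cm] := eqVneq c m; first exact: le_refl.
rewrite eq_sym in cm; have := osum_lt cm mc; have := mmax c isT => /=;
  have := lam_gt0 c.
by move=> *; exfalso; lra.
Qed.

Lemma osum_cover y : 0 <= y -> y < \sum_b lam b ->
  exists a, sigma a - lam a <= y /\ y < sigma a.
Proof.
move=> y0 y1; have [m mE] : exists m, sigma m = \sum_b lam b.
  apply: osum_total; apply: contrapT => nA.
  by move: y1; rewrite big1 => [|a]; [lra | case: nA; exists a].
have my : y < sigma m by rewrite mE.
case: (@Order.TotalTheory.arg_minP _ _ _ m (fun a => y < sigma a) sigma my).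
move=> a ya amin; exists a; split=> //; rewrite leNgt; apply/negP => yl.
case: (osum_pred a) => [a0|[c [ca _ cE]]]; first lra.
have := amin c; rewrite cE yl => /(_ isT) /=; have := lam_gt0 a; lra.
Qed.

End OrderedSums.

(** * Pieces of an interval exchange and their images *)

Section IntervalExchange.
Local Open Scope ring_scope.
Variables (R : realType) (A : finType) (T : interval_exchange R A).
Implicit Types (a b c : A) (x y z : R) (u v w : seq A).

Local Notation lo := (iet_lo T).
Local Notation hi := (iet_hi T).
Local Notation le1 := (iet_le1 T).
Local Notation le2 := (iet_le2 T).
Local Notation lam := (iet_lambda T).
Local Notation F := (iet_map T).

Definition in_unit z := (0 <= z) && (z < 1).
Definition in_piece a z := (lo a <= z) && (z < hi a).

Lemma in_pieceE a z : (z \in `[lo a, hi a[) = in_piece a z.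
Proof. by rewrite in_itv. Qed.

Lemma piece_lt a : lo a < hi a.
Proof.
have [_ _ /(_ a I)[x]] := iet_partition T; rewrite /= in_itv /=.
by case/andP; apply: le_lt_trans.
Qed.

Lemma lam_gt0 a : 0 < lam a.
Proof. by rewrite subr_gt0 piece_lt. Qed.

Lemma piece_unit a z : in_piece a z -> in_unit z.
Proof.
move=> az; have [cov _ _] := iet_partition T.
have : [set` `[(0 : R), 1[] z by rewrite -cov; exists a => //=;
  rewrite in_pieceE.
by rewrite /= in_itv.
Qed.

Lemma unit_piece z : in_unit z -> exists a, in_piece a z.
Proof.
move=> z01; have [cov _ _] := iet_partition T.
have : [set` `[(0 : R), 1[] z by rewrite /= in_itv.
by rewrite -cov => -[a _]; rewrite /= in_pieceE; exists a.
Qed.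

Lemma piece_uniq a b z : in_piece a z -> in_piece b z -> a = b.
Proof.
move=> az bz; have [_ dis _] := iet_partition T.
by apply: dis => //; exists z => /=; rewrite !in_pieceE.
Qed.

Lemma piece_lo a : in_piece a (lo a).
Proof. by rewrite /in_piece lexx piece_lt. Qed.

Lemma lo_ge0 a : 0 <= lo a.
Proof. by have /piece_unit/andP[] := piece_lo a. Qed.

Lemma hi_le1 a : hi a <= 1.
Proof.
rewrite leNgt; apply/negP => h1;
  suff /piece_unit : in_piece a 1 by rewrite /in_unit ltxx andbF.
by rewrite /in_piece h1 andbT ltW //; have /piece_unit/andP[] := piece_lo a.
Qed.

Lemma piece_order a b : a != b -> le1 a b -> hi a <= lo b.
Proof.
move=> ab leab; rewrite leNgt; apply/negP => ba.
have H := iet_ordered ab leab.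
have l : lo a < lo b by apply: H; rewrite in_pieceE piece_lo.
have : lo b < lo b by apply: H; rewrite in_pieceE ?piece_lo // /in_piece ba ltW.
by rewrite ltxx.
Qed.

Let le1_total a b : le1 a b || le1 b a.
Proof. by case: (iet_le1_order T). Qed.

(** Among the pieces ending at or before [lo a], the one with the greatest end [hi b] must end at
    [lo a]: otherwise the piece containing [hi b] would be another one, ending later. *)
Lemma lo_pred a : lo a = 0 \/ exists c, [/\ c != a, le1 c a & hi c = lo a].
Proof.
have [a0|a0] := eqVneq (lo a) 0; [by left | right].
have a1 := lo_ge0 a; have a2 := piece_lt a; have a3 := hi_le1 a.
have [b0 b00] : exists b, in_piece b 0 by apply: unit_piece;
  rewrite /in_unit lexx ltr01.
have b0a : hi b0 <= lo a.
  have nb : b0 != a by apply: contraNneq a0 => <-; rewrite eq_le lo_ge0 andbT;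
    case/andP: b00.
  case/orP: (le1_total b0 a) => [/(piece_order nb) //|].
  rewrite eq_sym in nb; move=> /(piece_order nb); case/andP: b00 => *; exfalso;
    lra.
case: (@Order.TotalTheory.arg_maxP _ _ _ b0 (fun c => hi c <= lo a) hi b0a) =>
  b ba bmax.
have bE : hi b = lo a.
  apply/eqP; rewrite eq_le ba /= leNgt; apply/negP => ltba.
  have [c /andP[c1 c2]] : exists c, in_piece c (hi b).
    apply: unit_piece; apply/andP; split; last lra.
    by have := lo_ge0 b; have := piece_lt b; lra.
  have nc : c != a by apply: contraTneq ltba => <-; rewrite -leNgt.
  case/orP: (le1_total c a) => [/(piece_order nc) ca|ac].
    by have := bmax c ca => /= ?; lra.
  by rewrite eq_sym in nc; have := piece_order nc ac; lra.
have nb : b != a by apply: contraTneq ba => ->; rewrite -ltNge piece_lt.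
exists b; split=> //; case/orP: (le1_total b a) => //.
rewrite eq_sym in nb; move=> /(piece_order nb); have := piece_lt b.
by move=> *; exfalso; lra.
Qed.

(** Identifies the points in the definition of regularity with ends of pieces, by induction on the
    number of letters below [a]. *)
Lemma hi_mu a : iet_mu T a = hi a.
Proof.
have [n] := ubnP #|[pred b | le1 b a]|; elim: n a => // n IH a an.
rewrite /iet_mu osumE //; last exact: iet_le1_order.
have hl c d : c != d -> le1 c d -> lo c < lo d.
  by move=> cd /(piece_order cd); apply: lt_le_trans; apply: piece_lt.
have anti c d : le1 c d -> le1 d c -> c = d.
  by case: (iet_le1_order T) => _ anti _ cd dc; apply: anti; rewrite cd dc.
have trans c d e : le1 c d -> le1 d e -> le1 c e.
  by case: (iet_le1_order T) => _ _ trans; apply: trans.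
case: (lo_pred a) => [a0|[c [ca lca cE]]].
  rewrite big1 => [|b /andP[ba nba]];
    first by rewrite addr0 /iet_lambda a0 subr0.
  by have := hl _ _ nba ba; have := lo_ge0 b; rewrite a0 => *; exfalso; lra.
rewrite (_ : \sum_(b | _) _ = iet_mu T c).
  rewrite IH; first by rewrite /iet_lambda cE subrK.
  rewrite -ltnS; apply: leq_trans an; rewrite ltnS; apply: proper_card;
    apply/properP; split.
    by apply/fintype.subsetP => d; rewrite !inE => dc; apply: trans dc lca.
  exists a; rewrite !inE; first by have := le1_total a a; rewrite orbb.
  by apply: contraNN ca => ac; apply/eqP/anti.
apply: eq_bigl => d; apply/andP/idP => [[da nda]|dc].
  case/orP: (le1_total d c) => // cd; have [->|nd] := eqVneq d c.
    by have := le1_total c c; rewrite orbb.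
  rewrite eq_sym in nd; have := piece_order nd cd; have := piece_order nda da.
  by have := piece_lt d; rewrite cE => *; exfalso; lra.
split; first exact: trans dc lca.
by apply: contraNneq ca => da; subst d; apply/eqP/anti.
Qed.

Lemma sum_lam : \sum_a lam a = 1.
Proof.
have [b _] : exists b, in_piece b 0 by apply: unit_piece;
  rewrite /in_unit lexx ltr01.
have [m mE] : exists m, iet_mu T m = \sum_a lam a.
  by apply: osum_total; [exact: iet_le1_order | exact: lam_gt0 | exists b].
rewrite -mE hi_mu; apply/eqP; rewrite eq_le hi_le1 leNgt; apply/negP => m1.
have [c /andP[c1 c2]] : exists c, in_piece c (hi m).
  apply: unit_piece; rewrite /in_unit m1 andbT.
  exact: ltW (le_lt_trans (lo_ge0 m) (piece_lt m)).
have := osum_le_total le1 lam_gt0 c; rewrite -mE -/(iet_mu T c) !hi_mu; lra.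
Qed.

Definition im_lo a : R := iet_nu T a - lam a.
Definition in_image a z := (im_lo a <= z) && (z < iet_nu T a).

Lemma im_lo_ge0 a : 0 <= im_lo a.
Proof. 
rewrite /im_lo subr_ge0; apply: osum_ge;
  [exact: iet_le2_order | exact: lam_gt0].
 Qed.

Lemma im_lt a : im_lo a < iet_nu T a.
Proof. by rewrite /im_lo ltrBlDr ltrDl lam_gt0. Qed.

Lemma image_unit a z : in_image a z -> in_unit z.
Proof.
case/andP => a1 a2; have := im_lo_ge0 a; have := osum_le_total le2 lam_gt0 a.
by rewrite sum_lam -/(iet_nu T a) => *; apply/andP; split; lra.
Qed.

Lemma unit_image z : in_unit z -> exists a, in_image a z.
Proof.
case/andP => z0 z1; have [|a [a1 a2]] := osum_cover (iet_le2_order T) lam_gt0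
  z0.
  by rewrite sum_lam.
by exists a; apply/andP.
Qed.

Lemma im_order a b : a != b -> le2 a b -> iet_nu T a <= im_lo b.
Proof. by move=> ab leab; apply: osum_lt => //;
  [exact: iet_le2_order | exact: lam_gt0]. Qed.

Lemma image_uniq a b z : in_image a z -> in_image b z -> a = b.
Proof.
case/andP => a1 a2 /andP[b1 b2]; have [//|ab] := eqVneq a b.
case: (iet_le2_order T) => tot _ _; case/orP: (tot a b) => [/(im_order ab)|].
  by move=> *; exfalso; lra.
by rewrite eq_sym in ab; move=> /(im_order ab) *; exfalso; lra.
Qed.

Lemma iet_mapE a z : in_piece a z -> F z = z + (im_lo a - lo a).
Proof.
move=> az; rewrite /iet_map; case: pickP => [b|/(_ a)]; rewrite in_pieceE;
  last by rewrite az.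
move=> bz; rewrite (piece_uniq bz az) /iet_alpha hi_mu /im_lo /iet_lambda; lra.
Qed.

Lemma iet_map_lo a : F (lo a) = im_lo a.
Proof. by rewrite (iet_mapE (piece_lo a)); lra. Qed.

Lemma iet_map_image a z : in_piece a z -> in_image a (F z).
Proof.
move=> az; rewrite (iet_mapE az); case/andP: az => a1 a2.
by rewrite /in_image /im_lo /iet_lambda; apply/andP; split; lra.
Qed.

Lemma iet_map_unit z : in_unit z -> in_unit (F z).
Proof. by move=> /unit_piece[a /iet_map_image /image_unit]. Qed.

Lemma iet_map_inj x y : in_unit x -> in_unit y -> F x = F y -> x = y.
Proof.
move=> /unit_piece[a ax] /unit_piece[b bx] xy.
have ab : a = b.
  apply: (@image_uniq _ _ (F x)); first exact: iet_map_image.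
  by rewrite xy; apply: iet_map_image.
by move: xy; rewrite (iet_mapE ax) (iet_mapE bx) ab => /addIr.
Qed.

Lemma iet_map_surj a y : in_image a y -> exists2 z, in_piece a z & F z = y.
Proof.
case/andP=> y0 y1; have az : in_piece a (y - (im_lo a - lo a)).
  by move: y0 y1; rewrite /in_piece /im_lo /iet_lambda => *; apply/andP; split;
    lra.
by exists (y - (im_lo a - lo a)) => //; rewrite (iet_mapE az) subrK.
Qed.

Lemma iet_iter_unit k z : in_unit z -> in_unit (iter k F z).
Proof. by move=> z1; elim: k => //= k; apply: iet_map_unit. Qed.

Lemma iet_iter_inj k x y : in_unit x -> in_unit y ->
  iter k F x = iter k F y -> x = y.
Proof.
by move=> x1 y1; elim: k =>
  //= k IH /(iet_map_inj (iet_iter_unit k x1) (iet_iter_unit k y1))/IH.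
Qed.

(** * Cylinders and the language of the exchange *)

Fixpoint codes w z : bool :=
  if w is a :: w' then in_piece a z && codes w' (F z) else true.

Definition iet_language : set (seq A) :=
  [set w | exists2 z, in_unit z & codes w z].

Lemma codes_cat u v z :
  codes (u ++ v) z = codes u z && codes v (iter (size u) F z).
Proof. by elim: u z => //= a u IH z; rewrite IH andbA -iterSr. Qed.

Lemma codes_rcons w b z :
  codes (rcons w b) z = codes w z && in_piece b (iter (size w) F z).
Proof. by rewrite -cats1 codes_cat /= andbT. Qed.

Lemma codes_exists n z : in_unit z -> exists2 w, size w = n & codes w z.
Proof.
elim: n z => [|n IH] z z1; first by exists [::].
have [a az] := unit_piece z1.
have [w sw wz] := IH _ (iet_map_unit z1).
by exists (a :: w); rewrite /= ?sw // az.
Qed.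

Lemma codes_uniq v w z : size v = size w -> codes v z -> codes w z -> v = w.
Proof.
elim: v w z => [|a v IH] [|b w] z //= [sv] /andP[az vz] /andP[bz wz].
by rewrite (piece_uniq az bz) (IH w (F z)).
Qed.

Lemma codes_shift w z z' : codes w z -> codes w z' ->
  iter (size w) F z' = iter (size w) F z + (z' - z).
Proof.
elim: w z z' => [|a w IH] z z' /=; first by move=> _ _; lra.
move=> /andP[az wz] /andP[az' wz']; rewrite -!iterS !iterSr (IH _ _ wz wz').
by rewrite (iet_mapE az) (iet_mapE az'); lra.
Qed.

Lemma codes_convex w x y z : codes w x -> codes w y -> x <= z -> z <= y ->
  codes w z.
Proof.
elim: w x y z => [//|a w IH] x y z /= /andP[ax wx] /andP[ay wy] xz zy.
have az : in_piece a z.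
  case/andP: ax => a1 _; case/andP: ay => _ a2; apply/andP; split.
    exact: le_trans xz.
  exact: le_lt_trans a2.
rewrite az; apply: IH wx wy _ _;
  rewrite (iet_mapE az) ?(iet_mapE ax) ?(iet_mapE ay); lra.
Qed.

(** A letter [b] added at the end either keeps the minimum or moves it to the point that reaches
    [lo b]; in the second case the old minimum reached a nonnegative value below [lo b], so [lo b]
    is nonzero. *)
Lemma codes_min w z : in_unit z -> codes w z -> exists c : R,
  [/\ in_unit c, codes w c, forall z', in_unit z' -> codes w z' -> c <= z'
    & c = 0 \/ exists i b, [/\ (i < size w)%N, iter i F c = lo b & lo b != 0]].
Proof.
elim/last_ind: w => [|w b IH] z1; first move=> _.
  exists 0; split=> //;
    [by rewrite /in_unit lexx ltr01 | by move=> z' /andP[] | by left].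
rewrite codes_rcons => /andP[wz /andP[bz1 bz2]].
have [c [c1 wc cmin cE]] := IH z1 wz; have cz := cmin z z1 wz.
have cs := codes_shift wc wz; rewrite size_rcons.
have [bc|cb] := lerP (lo b) (iter (size w) F c).
  exists c; split=> //.
  - by rewrite codes_rcons wc /in_piece bc; lra.
  - by move=> z' z1'; rewrite codes_rcons => /andP[+ _]; apply: cmin.
  - case: cE => [->|[i [d [iw ce d0]]]]; first by left.
    by right; exists i, d; split => //; apply: leqW.
pose c' := c + (lo b - iter (size w) F c).
have cc' : c <= c' by rewrite /c'; lra.
have c'z : c' <= z by rewrite /c'; lra.
have wc' : codes w c' by apply: codes_convex wc wz _ _.
have c'E : iter (size w) F c' = lo b by rewrite (codes_shift wc wc') /c'; lra.
exists c'; split.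
- by move: c1 z1 => /andP[c0 c1] /andP[z0 z1]; apply/andP; split; lra.
- by rewrite codes_rcons wc' c'E piece_lo.
- move=> z' z1'; rewrite codes_rcons => /andP[wz' /andP[bz' _]].
  by have := codes_shift wc' wz'; rewrite c'E; lra.
- right; exists (size w), b; split => //.
  have /andP[] := iet_iter_unit (size w) c1; move=> p0 _.
  by apply/eqP => b0; move: cb; rewrite b0 ltNge p0.
Qed.

Lemma language_cons a w : iet_language (a :: w) <->
  exists z, [/\ in_unit z, codes w z & in_image a z].
Proof.
split=> [[z z1 /= /andP[az wz]]|[z [z1 wz /iet_map_surj[y ay yz]]]].
  by exists (F z); split => //; [apply: iet_map_unit | apply: iet_map_image].
by exists y; [apply: piece_unit ay | rewrite /= ay yz].
Qed.

(* The points where a is the incoming letter and w is the outgoing word form a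
   semi-interval, closed on the left. *)
Lemma cell_min a w : iet_language (a :: w) -> exists p,
  [/\ in_unit p, codes w p, in_image a p &
      forall z, in_unit z -> codes w z -> in_image a z -> p <= z].
Proof.
move=> [z z1 awz]; have [c [c1 /= /andP[ac wc] cmin _]] := codes_min z1 awz.
exists (F c); split => //; [exact: iet_map_unit | exact: iet_map_image |].
move=> y y1 wy /iet_map_surj[x ax xy].
have := cmin x (piece_unit ax); rewrite /= ax xy wy => /(_ isT) cx.
by rewrite -xy (iet_mapE ax) (iet_mapE ac); lra.
Qed.

(** * Regularity and extension trees *)

Section Regular.
Hypothesis regT : iet_regular T.

Let D : set R := [set` `[0, 1[].

Lemma iet_pinvK z : in_unit z -> 'pinv_id D F (F z) = z.
Proof.
move=> z1; apply: pinvKV; last by rewrite inE /D /= in_itv.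
by move=> x y; rewrite !inE /D /= !in_itv; apply: iet_map_inj.
Qed.

Lemma finite_periodic_orbit x k : (0 < k)%N -> in_unit x -> iter k F x = x ->
  finite_set (iet_orbit T x).
Proof.
move=> k0 x1 xk; apply:
  (@sub_finite_set _ _ [set` [seq iter i F x | i <- iota 0 k]]) => //.
suff main (n : int) : exists2 i, (i < k)%N & iet_iter T n x = iter i F x.
  by move=> _ [n _ <-] /=; have [i ik ->] := main n; apply: map_f;
    rewrite mem_iota.
case: n => [n|n].
  exists (n %% k)%N; first by rewrite ltn_mod.
  rewrite /= {1}(divn_eq n k) addnC iterD; congr iter.
  by elim: (n %/ k)%N => //= q IH; rewrite mulSn iterD IH.
rewrite /iet_iter -/D; elim: n.+1 => [|m [i ik IH]]; first by exists 0%N.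
rewrite iterS IH; case: i ik {IH} => [|i] ik.
  exists k.-1; first by rewrite prednK.
  rewrite -{1}xk -{1}(prednK k0) iterS iet_pinvK //; exact: iet_iter_unit.
by exists i; [apply: ltnW | rewrite iterS iet_pinvK //; apply: iet_iter_unit].
Qed.

Lemma lo_separation b : lo b != 0 ->
  exists2 c, iet_separation_letter T c & iet_mu T c = lo b.
Proof.
case: (lo_pred b) => [->|[c [cb lcb cE]] _]; first by rewrite eqxx.
by exists c; [exists b | rewrite hi_mu].
Qed.

(** If the two separation letters are equal, the orbit is periodic, hence finite; if they are
    distinct, their orbits meet. *)
Lemma no_connection a b k : (0 < k)%N -> lo a != 0 -> lo b != 0 ->
  iter k F (lo a) = lo b -> False.
Proof.
move=> k0 /lo_separation[c csep cE] /lo_separation[d dsep dE] ab.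
have [inf disj] := regT.
have [cd|cd] := eqVneq c d.
  apply: (inf c csep); apply: (finite_periodic_orbit k0).
    by rewrite cE; apply: piece_unit (piece_lo a).
  by rewrite cE ab -dE -cd cE.
have := disj c d csep dsep cd; rewrite cE dE => /seteqP[/(_ (lo b)) + _]; apply.
by split; [exists (Posz k) | exists (Posz 0)].
Qed.

Lemma lo_eq0 a b : lo a = 0 -> lo b = 0 -> a = b.
Proof.
by move=> a0 b0; apply: (@piece_uniq _ _ 0); [rewrite -a0 | rewrite -b0];
  apply: piece_lo.
Qed.

Lemma im_first : exists a, im_lo a = 0.
Proof.
have [|a a0] := @unit_image 0; first by rewrite /in_unit lexx ltr01.
by exists a; apply/eqP; rewrite eq_le im_lo_ge0 andbT; case/andP: a0.
Qed.

(** [im_lo a] is the image of [lo a], which settles the case [lo a != 0]. If [lo a = 0], the letter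
    [f] with [im_lo f = 0] has [lo f != 0] and reaches [im_lo a] in two steps. *)
Lemma no_connection_im a b k : im_lo a != 0 -> lo b != 0 ->
  iter k F (im_lo a) = lo b -> False.
Proof.
move=> a0 b0 ab; have [la|la] := eqVneq (lo a) 0; last first.
  by apply: (@no_connection a b k.+1) => //; rewrite iterSr iet_map_lo.
have [f f0] := im_first; have [lf|lf] := eqVneq (lo f) 0.
  by move: a0; rewrite (lo_eq0 la lf) f0 eqxx.
apply: (@no_connection f b k.+2) => //; rewrite !iterSr iet_map_lo f0 -la.
by rewrite iet_map_lo.
Qed.

(** Unless [y] is at once [im_lo a] and the point that reaches [lo b], one can move a little to the
    left of [y] without leaving one of the two intervals; [no_connection_im] excludes the
    exceptional case. *)
Lemma cell_overlap u a b y z : in_unit y -> codes (rcons u b) y ->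
  in_image a y -> in_unit z -> codes u z -> z < y ->
  exists t, [/\ in_unit t, codes u t,
    t < y & in_image a t \/ codes (rcons u b) t].
Proof.
move=> y1 uby ay z1 uz zy; have := uby; rewrite codes_rcons => /andP[uy by1].
have yz := codes_shift uz uy.
have ge t : z <= t -> t < y -> in_unit t /\ codes u t.
  move=> zt ty; split; last by apply: codes_convex uz uy zt (ltW ty).
  by case/andP: y1 z1 => ? ? /andP[? ?]; apply/andP; split; lra.
case/andP: ay => ay1 ay2; have [ay3|ay3] := ltrP (im_lo a) y.
  have zt : z <= Num.max z (im_lo a) by rewrite le_max lexx.
  have ty : Num.max z (im_lo a) < y by rewrite gt_max zy.
  have [t1 ut] := ge _ zt ty; exists (Num.max z (im_lo a)); split => //; left.
  by rewrite /in_image le_max lexx orbT (lt_trans ty ay2).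
have {ay1 ay3}ya : im_lo a = y by apply/eqP; rewrite eq_le ay1.
case/andP: by1 => by1 by2; have [by3|by3] := ltrP (lo b) (iter (size u) F y).
  pose s := y - (iter (size u) F y - lo b).
  have zt : z <= Num.max z s by rewrite le_max lexx.
  have ty : Num.max z s < y by rewrite gt_max zy /s /=; lra.
  have [t1 ut] := ge _ zt ty; exists (Num.max z s); split => //; right.
  have st : s <= Num.max z s by rewrite le_max lexx orbT.
  rewrite codes_rcons ut /in_piece (codes_shift uy ut) /=; move: st;
    rewrite /s => st.
  by apply/andP; split; lra.
have by4 : iter (size u) F y = lo b by apply/eqP; rewrite eq_le by1 by3.
have /andP[z0 _] := iet_iter_unit (size u) z1; case/andP: z1 => z1 _.
exfalso; apply: (@no_connection_im a b (size u)); rewrite ?ya //; apply/eqP;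
  lra.
Qed.

(** The cells of the pairs [(a, b)] are added from left to right. [cell_overlap] makes each new cell
    share a letter with an earlier one; sharing both would push its left end [y] further left. *)
Lemma iet_extension_tree u : iet_language u -> extension_tree iet_language u.
Proof.
move=> Lu; pose E := [pred e : A * A | `[< iet_language (e.1 ::
  rcons u e.2) >]].
have pex (e : A * A) : exists q, E e -> [/\ in_unit q, codes (rcons u e.2) q,
    in_image e.1 q & forall z, in_unit z -> codes (rcons u e.2) z ->
    in_image e.1 z -> q <= z].
  have [/asboolP/cell_min[q qE]|nE] := boolP (E e); first by exists q.
  by exists 0.
have [p pE] := choice pex.
have p_inj : {in E &, injective p}.
  move=> [a b] [a' b'] /pE[/= p1 p2 p3 _] /pE[/= q1 q2 q3 _] pq.
  move: q2 q3; rewrite -pq => q2 q3; rewrite (image_uniq p3 q3); congr pair.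
  by have /rcons_inj[] := codes_uniq (etrans (size_rcons u b) (esym (size_rcons
    u b'))) p2 q2.
(* Left ends decrease along [s], because [tree_order] builds the tree from the end of the list. *)
pose s := sort (fun e e' => p e' <= p e) (enum E).
have sE e : e \in s = E e by rewrite mem_sort mem_enum.
exists s; last by move=> a b; rewrite sE; split => [/asboolP|/asboolP].
have s_sorted : pairwise (fun e e' => p e' < p e) s.
  have : pairwise (fun e e' => p e' <= p e) s.
    rewrite -sorted_pairwise; first by apply: sort_sorted => e e';
      apply: le_total.
    by move=> e1 e2 e3 /= h1 h2; apply: le_trans h2 h1.
  have : uniq s by rewrite sort_uniq enum_uniq.
  have : all E s by apply/allP => e; rewrite sE.
  elim: s {sE} => //= e s IH /andP[Ee Es] /andP[nes us] /andP[les ps].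
  rewrite IH // andbT; apply/allP => e' es;
    rewrite lt_neqAle (allP les) // andbT.
  apply: contraNneq nes => pe; suff <- : e' = e by [].
  by apply: p_inj => //; apply: (allP Es).
have : all E s by apply/allP => e; rewrite sE.
(* Invariant of the induction: the edges already listed include every cell further left than one of
   them. *)
have : forall e e', E e -> e' \in s -> p e < p e' -> e \in s.
  by move=> e e' Ee _ _; rewrite sE.
elim: s s_sorted {sE} => //= -[a b] s IH /andP[/allP lts ps] down /andP[Eab Es].
have down_s e e' : E e -> e' \in s -> p e < p e' -> e \in s.
  move=> Ee e's pe; have := down e e' Ee; rewrite inE e's orbT => /(_ isT pe).
  by move=> /predU1P[ee|//]; have := lts e' e's; rewrite -ee => /(lt_trans pe);
    rewrite ltxx.
rewrite IH //=; have [->//|s0] := eqVneq s [::].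
have [e1 e1s] : exists e, e \in s by case: (s) s0 => // e ?; exists e;
  rewrite mem_head.
have [y1 uby ay ymin] := pE _ Eab; rewrite /= in y1 uby ay ymin.
set y := p (a, b) in y1 uby ay ymin lts.
have sP e : e \in s -> [/\ in_unit (p e), codes (rcons u e.2) (p e),
  in_image e.1 (p e)
    & p e < y].
  by move=> es; have [q1 q2 q3 _] := pE _ (allP Es _ es); split => //;
    apply: lts.
have u_of c z : codes (rcons u c) z -> codes u z by rewrite codes_rcons =>
  /andP[].
have [z1 uz _ zy] := sP _ e1s.
have [t [t1 ut ty tE]] := cell_overlap y1 uby ay z1 (u_of _ _ uz) zy.
have [a' a't] := unit_image t1.
have [b' b't] := unit_piece (iet_iter_unit (size u) t1).
have ub't : codes (rcons u b') t by rewrite codes_rcons ut.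
have Eab' : E (a', b') by apply/asboolP/language_cons; exists t; split.
have [_ _ _ /= /(_ t t1 ub't a't) pt] := pE _ Eab'.
have pyt : p (a', b') < y by apply: le_lt_trans pt ty.
have ab's : (a', b') \in s.
  have := down _ (a, b) Eab' (mem_head _ _) pyt; rewrite inE => /predU1P[ee|//].
  by move: pyt; rewrite /y -ee ltxx.
have bb' : codes (rcons u b) t -> b' = b.
  move=> ubt; have e : size (rcons u b') = size (rcons u b)
    by rewrite !size_rcons.
  by have /rcons_inj[] := codes_uniq e ub't ubt.
(* If both letters occurred earlier, the larger of the two left ends would lie in the cell of
   [(a, b)], before its minimum [y]. *)
have notboth : ~~ ((a \in map fst s) && (b \in map snd s)).
  apply/negP => /andP[/mapP[[a1 b1] m1s /= a1E] /mapP[[a2 b2] m2s /= b2E]].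
  subst a1 b2.
  have [n1 _ /andP[n3 _] n4] := sP _ m1s; have [k1 k2 _ k4] := sP _ m2s.
  rewrite /= in n3 k2; pose m := Num.max (p (a, b1)) (p (a2, b)).
  have my : m < y by rewrite gt_max n4 k4.
  suff : y <= m by rewrite leNgt my.
  apply: ymin.
  - by rewrite /m; case: ltP.
  - by apply: codes_convex k2 uby _ (ltW my); rewrite le_max lexx orbT.
  - case/andP: ay => _ ay; rewrite /in_image (lt_trans my ay) andbT.
    by apply: le_trans n3 _; rewrite le_max lexx.
case: tE => [at_|/bb' b'b].
  have ain : a \in map fst s by apply/mapP; exists (a', b') => //=;
    apply: image_uniq at_ a't.
  by move: notboth; rewrite ain /= => /negPf->; rewrite ?orbT.
have bin : b \in map snd s by apply/mapP; exists (a', b').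
by move: notboth; rewrite bin andbT => /negPf->; rewrite ?orbT.
Qed.

Lemma iet_tree_language : tree_language iet_language.
Proof.
split.
- move=> u v w [z z1]; rewrite !codes_cat => /and3P[_ vz _].
  by exists (iter (size u) F z) => //; apply: iet_iter_unit.
- move=> w [z z1 wz]; have [a az] := unit_image z1.
  by exists a; apply/language_cons; exists z.
- move=> w [z z1 wz]; have [b bz] := unit_piece (iet_iter_unit (size w) z1).
  by exists b, z; rewrite ?codes_rcons ?wz.
- by exists 0; rewrite /in_unit ?lexx ?ltr01.
- by move=> a; exists (lo a); rewrite /= ?piece_lo //;
  apply: piece_unit (piece_lo a).
- exact: iet_extension_tree.
Qed.

(** * Uniform recurrence *)

Section Aperiodic.
Variables a0 b0 : A.
(** With a single letter the exchange is the identity and every point is periodic. *)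
Hypothesis ab0 : a0 != b0.

(* Sliding a periodic point to the left end of its cylinder yields a periodic
   separation point, or the periodic point 0. *)
Lemma iet_aperiodic z k : in_unit z -> (0 < k)%N -> iter k F z != z.
Proof.
move=> z1 k0; apply/eqP => zk; have [w sw wz] := codes_exists k z1.
have [c [c1 wc _ cE]] := codes_min z1 wz.
have ck : iter k F c = c.
  by have := codes_shift wc wz; rewrite sw zk; lra.
case: cE => [c0|[i [b [_ ci bn0]]]]; last first.
  by apply: (no_connection k0 bn0 bn0); rewrite -ci -iterD addnC iterD ck.
subst c; have [f f0] := im_first.
have [lf|lf] := eqVneq (lo f) 0; last first.
  apply: (no_connection k0 lf lf); have lf1 := piece_unit (piece_lo f).
  apply: iet_map_inj => //; first exact: iet_iter_unit.
  by rewrite -iterS iterSr iet_map_lo f0.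
(* Now both orders begin with [f]. The second letter [b] of the first order has its piece starting
   at [y], the second letter [a] of the second order has its image starting there, and [lo a] is
   sent to [lo b]. *)
pose y := hi f; have ylt := piece_lt f.
have [g gf] : exists g, g != f.
  have [<-|?] := eqVneq a0 f; [by exists b0; rewrite eq_sym | by exists a0].
have tot1 c d : le1 c d || le1 d c by case: (iet_le1_order T).
have tot2 c d : le2 c d || le2 d c by case: (iet_le2_order T).
have after c : c != f -> hi f <= lo c.
  move=> cf; case/orP: (tot1 f c) => [|/(piece_order cf)].
    by rewrite eq_sym in cf; apply: piece_order.
  by have := piece_lt c; have := lo_ge0 c; lra.
have y1 : in_unit y.
  have := after g gf; have := piece_lt g; have := hi_le1 g.
  by move=> *; apply/andP; split; rewrite /y; lra.
have [b /andP[yb1 yb2]] := unit_piece y1.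
have bf : b != f by apply: contraTneq yb2 => ->; rewrite -leNgt.
have lby : lo b = y by have := after b bf; rewrite /y in yb1 *; lra.
have nuf : iet_nu T f = y by move: f0; rewrite /im_lo /iet_lambda lf /y; lra.
have [a /andP[ya1 ya2]] := unit_image y1.
have af : a != f by apply: contraTneq ya2 => ->; rewrite -leNgt nuf.
have ay : im_lo a = y.
  case/orP: (tot2 f a) => [|/(im_order af)]; last by rewrite f0;
    have := im_lt a; have := im_lo_ge0 a; lra.
  by rewrite eq_sym in af; move=> /(im_order af); rewrite nuf; lra.
have la : lo a != 0 by apply: contraNneq af => la; apply/eqP/lo_eq0.
apply: (@no_connection a b 1) => //; first by rewrite lby /y; apply/eqP; lra.
by rewrite /= iet_map_lo ay lby.
Qed.

Lemma codes_right w z : in_unit z -> codes w z ->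
  exists2 e, 0 < e & forall t, z <= t -> t < z + e -> in_unit t /\ codes w t.
Proof.
move=> z1; elim/last_ind: w => [|w b IH].
  case/andP: z1 => z0 z1 _; exists (1 - z); first lra.
  by move=> t zt t1; split => //; apply/andP; split; lra.
rewrite codes_rcons => /andP[wz /andP[b1 b2]].
have [e e0 eE] := IH wz; exists (Num.min e (hi b - iter (size w) F z)).
  by rewrite lt_min e0 subr_gt0.
move=> t zt; rewrite -ltrBlDl lt_min => /andP[te tb].
have [|t1 wt] := eE t zt; first lra.
by split => //; rewrite codes_rcons wt /in_piece (codes_shift wz wt);
  apply/andP; split; lra.
Qed.

(** Pigeonhole: among [N + 1] points, two lie in the same box [[q l, (q + 1) l[], as only [N] values
    of [q] are possible. *)
Lemma small_gap (x : nat -> R) l : 0 < l -> (forall k, in_unit (x k)) ->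
  exists k r, (0 < r)%N /\ `|x (k + r)%N - x k| < l.
Proof.
move=> l0 x1; have il0 : 0 < l^-1 by rewrite invr_gt0.
have ll : l * l^-1 = 1 by rewrite mulfV // lt0r_neq0.
pose N := (Num.truncn (l^-1)).+1.
have lN : l^-1 < N%:R by have /andP[] := truncn_itv (ltW il0).
have x0 k : 0 <= x k * l^-1 by rewrite mulr_ge0 ?(ltW il0) //;
  case/andP: (x1 k).
have fP k : (Num.truncn (x k * l^-1) < N)%N.
  have /andP[h _] := truncn_itv (x0 k); rewrite -(ltr_nat R).
  apply: le_lt_trans h (lt_trans _ lN); case/andP: (x1 k) => _ h1; nra.
pose f (k : 'I_N.+1) : 'I_N := Ordinal (fP k).
have /injectivePn[i [j ij]] : ~~ injectiveb f.
  by apply/injectiveP => /leq_card; rewrite !card_ord ltnn.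
wlog lij : i j ij / (i < j)%N => [wl|] fij.
  have [|ji|e] := ltngtP i j; first by move=> ?; apply: (wl i j).
    by apply: (wl j i) => //; rewrite eq_sym.
  by case/eqP: ij; apply: val_inj.
exists i, (j - i)%N; rewrite subn_gt0 lij subnKC ?(ltnW lij) //; split=> //.
have /andP[i1 i2] := truncn_itv (x0 i); have /andP[j1 j2] := truncn_itv (x0 j).
have := congr1 val fij => /= e; rewrite -e in j1 j2.
move: i2 j2; rewrite -natr1; set q := _%:R in i1 j1 *; move=> i2 j2.
have : `|x j * l^-1 - x i * l^-1| < 1 by rewrite ltr_norml; lra.
by rewrite -mulrBl normrM (gtr0_norm il0) -ltr_pdivlMr // div1r invrK.
Qed.

(* If the cylinder of u were never cut, T would act on it by translations, two
   iterates overlap, and the overlap repeats: either the cylinder drifts out of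
   the unit interval or it consists of periodic points. *)
Lemma cylinder_cut u : iet_language u ->
  ~ (forall v b b', iet_language (rcons (u ++ v) b) ->
     iet_language (rcons (u ++ v) b') -> b = b').
Proof.
move=> [z z1 uz] nocut; have [e e0 eE] := codes_right z1 uz.
pose l := e / 2; have l0 : 0 < l by rewrite /l; lra.
have nocut_uniq v v' : iet_language (u ++ v) -> iet_language (u ++ v') ->
    size v = size v' -> v = v'.
  elim/last_ind: v v' => [|v b IH] v'; first by move=> _ _ /esym/size0nil.
  case/lastP: v' => [|v' b']; first by rewrite size_rcons.
  rewrite !size_rcons -!rcons_cat => Lv Lv' [svv'].
  have [y y1] := Lv; rewrite codes_rcons => /andP[vy _].
  have [y' y1'] := Lv'; rewrite codes_rcons => /andP[vy' _].
  have vv' : v = v' by apply: IH => //; [exists y | exists y'].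
  by subst v'; rewrite (nocut v b b').
have trans n y : z <= y -> y < z + e -> iter n F y = y + (iter n F z - z).
  move=> zy ye; have [y1 uy] := eE y zy ye.
  have [w sw wz] := codes_exists n z1; have [w' sw' wy] := codes_exists n y1.
  have [v sv vz] := codes_exists n (iet_iter_unit (size u) z1).
  have [v' sv' vy] := codes_exists n (iet_iter_unit (size u) y1).
  have vv' : v = v'.
    apply: nocut_uniq; last by rewrite sv.
      by exists z; rewrite ?codes_cat ?uz.
    by exists y; rewrite ?codes_cat ?uy.
  have uvz : codes (u ++ v) z by rewrite codes_cat uz.
  have uvy : codes (u ++ v) y by rewrite codes_cat uy vv'.
  have tn : size (take n (u ++ v)) = n
    by rewrite size_takel // size_cat sv leq_addl.
  move: uvz uvy; rewrite -(cat_take_drop n (u ++ v)) !codes_cat =>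
    /andP[nz _] /andP[ny _].
  by have := codes_shift nz ny; rewrite tn; lra.
pose c n := iter n F z - z.
have cb n : `|c n| < 1.
  have /andP[h1 h2] := iet_iter_unit n z1; case/andP: z1 => h3 h4.
  by rewrite ltr_norml /c; lra.
have [k [r [r0 gap]]] := small_gap l0 (fun n => iet_iter_unit n z1).
pose t := c (k + r)%N - c k.
have tl : `|t| < l by rewrite /t /c (_ :
  _ - _ = iter (k + r) F z - iter k F z) //; lra.
(* The iterates of orders [k + r] and [k] of the interval overlap, with offset [t]; applying the map
   [n - k] more times carries the relation to every later order. *)
have cstep n : (k <= n)%N -> c (n + r)%N = c n + t.
  move=> kn; move: tl; rewrite ltr_norml /l => /andP[t1 t2].
  have [y [zy ye zyt yte]] : exists y, [/\ z <= y, y < z + e,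
    z <= y + t & y + t < z + e].
    have [t0|t0] := lerP 0 t; first by exists z; split; lra.
    by exists (z - t); split; lra.
  have h1 : iter (k + r) F y = iter k F (y + t).
    by rewrite (trans _ y) // (trans _ (y + t)) // /t /c; lra.
  have : iter (n + r) F y = iter n F (y + t).
    by rewrite -(subnK kn) -addnA iterD h1 -iterD.
  by rewrite (trans _ y) // (trans _ (y + t)) // /c; lra.
have cj j : c (k + j * r)%N = c k + t *+ j.
  elim: j => [|j IH]; first by rewrite mul0n addn0 mulr0n addr0.
  by rewrite mulSnr addnA (cstep _ (leq_addr _ _)) IH -addrA -mulrSr.
have [t0|tn0] := eqVneq t 0.
  have /eqP nper := iet_aperiodic (iet_iter_unit k z1) r0; apply: nper.
  by rewrite -iterD addnC; move: t0; rewrite /t /c; lra.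
pose j := Num.bound (2 / `|t|); have tp : 0 < `|t| by rewrite normr_gt0.
have : 2 / `|t| < j%:R by apply: archi_boundP; rewrite divr_ge0.
rewrite ltr_pdivrMr // => big.
have := cb (k + j * r)%N; have := cb k;
  rewrite cj !ltr_norml => /andP[h1 h2] /andP[h3 h4].
have : `|t *+ j| < 2 by rewrite ltr_norml; lra.
by rewrite normrMn -mulr_natl => ?; lra.
Qed.

Definition right_special w : Prop :=
  exists b b', [/\ b != b',
    iet_language (rcons w b) & iet_language (rcons w b')].

Lemma right_special_extension u : iet_language u -> exists v,
  right_special (u ++ v).
Proof.
move=> Lu; apply: contrapT => no; apply: (cylinder_cut Lu) => v b b' Lb Lb'.
by have [//|bb'] := eqVneq b b'; case: no; exists v, b, b'.
Qed.

(** The cylinder of [w] is an interval, so between two points followed by different letters it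
    contains one that reaches the left end of the later piece. *)
Lemma right_special_point w : right_special w ->
  exists b y, [/\ in_unit y, codes w y & iter (size w) F y = lo b].
Proof.
move=> [b [b' [bb' Lb Lb']]].
wlog : b b' bb' Lb Lb' / le1 b b' => [wl|lebb'].
  have tot : le1 b b' || le1 b' b by case: (iet_le1_order T).
  by case/orP: tot => [/wl|/wl]; apply=> //; rewrite eq_sym.
have ord := piece_order bb' lebb'.
case: Lb Lb' => z z1; rewrite codes_rcons => /andP[wz /andP[bz1 bz2]].
case=> z' z1'; rewrite codes_rcons => /andP[wz' /andP[bz1' bz2']].
have sh := codes_shift wz wz'.
pose y := z + (lo b' - iter (size w) F z).
have zy : z <= y by rewrite /y; lra.
have yz' : y <= z' by rewrite /y; lra.
have wy := codes_convex wz wz' zy yz'.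
exists b', y; split=> //; last by rewrite (codes_shift wz wy) /y; lra.
by case/andP: z1 z1' => ? ? /andP[? ?]; apply/andP; split; lra.
Qed.

Local Open Scope nat_scope.

Section Return.
Variable w0 : seq A.

Let single r := [/\ iet_language r, prefix w0 r & ~~ infix w0 (behead r)].

(* The orbit of a separation point enters a suffix code at most once. *)
Lemma single_special_bound : exists n, forall r, single r -> right_special r ->
  size r <= n.
Proof.
have bnd b : exists n, forall r y, single r -> in_unit y -> codes r y ->
    iter (size r) F y = lo b -> size r <= n.
  have [[r [y [sr y1 ry yb]]]|no] := pselect (exists r y, [/\ single r,
    in_unit y,
      codes r y & iter (size r) F y = lo b]); last first.
    by exists 0 => r y sr y1 ry yb; case: no; exists r, y.
  exists (size r) => r' y' sr' y1' ry' yb'; rewrite leqNgt; apply/negP => lt.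
  (* Both words lead to the same [lo b], so the shorter is a suffix of the longer, which then
     contains [w0] a second time. *)
  pose d := size r' - size r; have d0 : 0 < d by rewrite subn_gt0.
  have dE : iter d F y' = y.
    apply: (@iet_iter_inj (size r)) => //; first exact: iet_iter_unit.
    by rewrite -iterD /d subnKC ?(ltnW lt) // yb' yb.
  have drE : drop d r' = r.
    have sd : size (drop d r') = size r by rewrite size_drop subKn // ltnW.
    apply: codes_uniq sd _ ry.
    move: ry'; rewrite -{1}(cat_take_drop d r') codes_cat size_takel ?leq_subr
      // dE.
    by case/andP.
  case: sr' => _ _ /negP; apply; case: sr => _ pr _.
  apply: infix_trans (prefixW pr) _;
    rewrite -drE -(prednK d0) -[behead r']drop1.
  by rewrite -[d.-1.+1]addn1 -drop_drop suffixW // suffix_drop.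
have [n nE] := choice bnd;
  exists (\max_b n b) => r sr /right_special_point[b [y [y1 ry yb]]].
by apply: leq_trans (nE b r y sr y1 ry yb) _; apply: leq_bigmax.
Qed.

(** A word starting with [w0] and longer than [n0] cannot be both right special and free of a second
    [w0]. Each of the finitely many starting words [u] extends to a right special [u ++ v0]; a long
    word either follows it to the end or leaves it at a right special prefix, unless [w0] has
    recurred before, and [w0] recurs in all cases. *)
Lemma bounded_return : exists M, forall v, iet_language v -> M <= size v ->
  prefix w0 v -> infix w0 (behead v).
Proof.
have [n0 n0E] := single_special_bound; pose n := maxn n0.+1 (size w0).
have tL := iet_tree_language.
have behead_infix s t : prefix s t -> infix w0 (behead s) ->
  infix w0 (behead t).
  case: s => [|x s]; first by move=> _; rewrite infixs0 => /eqP->;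
    apply: infix0s.
  case: t => // x' t; rewrite prefix_cons => /andP[_ st].
  by move=> /infix_trans; apply; apply: prefixW.
have ret (u : n.-tuple A) : exists M, single u -> forall t, iet_language t ->
    prefix u t -> M <= size t -> infix w0 (behead t).
  have [su|nsu] := pselect (single u); last by exists 0.
  have [Lu pu _] := su; have [v0 rs0] := right_special_extension Lu.
  have n0u v : n0 < size (u ++ v).
    by rewrite size_cat size_tuple ltn_addr // /n leq_max ltnSn.
  have puv v : prefix w0 (u ++ v) by apply: prefix_catl.
  have nsingle v : iet_language (u ++ v) -> right_special (u ++ v) ->
      infix w0 (behead (u ++ v)).
    move=> Luv rs; apply/negPn/negP => no.
    by have := n0u v; rewrite ltnNge n0E.
  exists (size (u ++ v0)) => _ t Lt ut st.
  have Luv0 : iet_language (u ++ v0).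
    by case: rs0 => b [_ [_ Lb _]]; apply: (@tree_catl _ _ tL _ [:: b]);
      rewrite cats1.
  have : infix w0 (behead t) \/ prefix (u ++ v0) t.
    elim/last_ind: v0 Luv0 st {rs0} => [|v b IH]; first by rewrite cats0; right.
    rewrite -rcons_cat size_rcons => Lvb st.
    have Lv : iet_language (u ++ v) by apply: (@tree_catl _ _ tL _ [:: b]);
      rewrite cats1.
    case: (IH Lv (ltnW st)) => [|pt]; first by left.
    have [i|ni] := boolP (infix w0 (behead (u ++ v))).
      by left; apply: behead_infix i.
    right; case/prefixP: pt st Lt => [[|c s] ->]; first by rewrite cats0 ltnn.
    move=> _ Lc; have Lc' : iet_language (rcons (u ++ v) c).
      by apply: (@tree_catl _ _ tL _ s); rewrite cat_rcons.
    have [->|bc] := eqVneq b c; first by rewrite -cat_rcons prefix_prefix.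
    by case/negP: ni; apply: nsingle => //; exists b, c.
  by case=> // /behead_infix; apply; apply: nsingle.
have [M ME] := choice ret.
exists (maxn n (\max_u M u)) => v Lv; rewrite geq_max => /andP[nv Mv] pv.
have st : size (take n v) == n by rewrite size_takel.
pose u := Tuple st; have uv : prefix u v by apply: prefix_take.
have Lu : iet_language u by apply: (@tree_catl _ _ tL _ (drop n v));
  rewrite cat_take_drop.
have pu : prefix w0 u.
  rewrite prefixE /= take_takel ?leq_maxr //; by rewrite -prefixE.
have [i|ni] := boolP (infix w0 (behead u)).
  exact: behead_infix i.
apply: (ME u _ v) => //; apply: leq_trans Mv; exact: leq_bigmax.
Qed.

End Return.
End Aperiodic.

(* For long words, containing w is preserved along the edges of the Rauzy
   graph, forwards because w returns in bounded time, and backwards because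
   every edge recurs; connectedness concludes. *)
Lemma iet_uniformly_recurrent : uniformly_recurrent iet_language.
Proof.
have [[[a0 b0] /= ab0]|no] := pselect (exists e : A * A, e.1 != e.2);
  last first.
  have sub a b : a = b.
    by apply/eqP/negPn/negP => ab; apply: no; exists (a, b).
  have same : forall v w, size v = size w -> v = w.
    by elim=> [|a v IH] [|b w] //= [vw]; rewrite (sub a b) (IH w).
  move=> w _; exists (size w) => v _ wv; apply: prefixW; rewrite prefixE.
  by apply/eqP/same; rewrite size_takel.
have tL := iet_tree_language.
move=> w Lw; have [M ME] := bounded_return ab0 w.
pose n := maxn M (size w); exists n.+1.
have fwd a u b : size u = n -> iet_language (a :: rcons u b) ->
    infix w (a :: u) -> infix w (rcons u b).
  move=> su Laub; rewrite infix_consl => /orP[pw|wu].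
    apply: (ME (a :: rcons u b)) => //.
      by rewrite /= size_rcons su leqW // leqW // leq_maxl.
    by rewrite -rcons_cons -cats1 prefix_catl.
  by apply: infix_trans wu _; rewrite -cats1 prefix_infix.
have fwds (y s : seq A) : size y = n.+1 -> iet_language (y ++ s) -> infix w y ->
    infix w (drop (size s) (y ++ s)).
  move=> sy; elim/last_ind: s => [|s b IH]; first by rewrite cats0 drop0.
  rewrite -rcons_cat size_rcons => Lysb wy.
  have Lys : iet_language (y ++ s) by apply: (@tree_catl _ _ tL _ [:: b]);
    rewrite cats1.
  have := IH Lys wy; have : size (drop (size s) (y ++ s)) = n.+1.
    by rewrite size_drop size_cat sy addnK.
  have sds : (size s <= size (y ++ s))%N by rewrite size_cat leq_addl.
  rewrite -[(size s).+1]add1n -drop_drop drop_rcons //.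
  have Ld : iet_language (rcons (drop (size s) (y ++ s)) b).
    by apply: (@tree_catr _ _ tL (take (size s) (y ++ s)));
      rewrite -rcons_cat cat_take_drop.
  case: (drop _ _) Ld => // a u Ld [su] wau; rewrite /= drop0.
  exact: fwd wau.
have bwd a u b : size u = n -> iet_language (a :: rcons u b) ->
    infix w (rcons u b) -> infix w (a :: u).
  move=> su Laub wub; have [Me MeE] := bounded_return ab0 (a :: rcons u b).
  have [r sr Lr] := tree_extr_size tL Me Laub.
  have := MeE _ Lr; rewrite size_cat sr leq_addl prefix_prefix => /(_ isT isT).
  rewrite /= => /infixP[s [t E]].
  (* [x] is a path from the vertex [rcons u b] to a later occurrence of [a :: u]; [fwds] carries [w]
     forward along it. *)
  pose x := s ++ a :: u;
    have sx : size x = (n.+1 + size s)%N by rewrite size_cat /= su addnC.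
  have xE : x = take (size x) (rcons u b ++ r).
    have -> : rcons u b ++ r = x ++ b :: t by rewrite E /x -catA /= cat_rcons.
    by rewrite take_size_cat.
  have sub : size (rcons u b) = n.+1 by rewrite size_rcons su.
  have xub : x = rcons u b ++ take (size s) r.
    by rewrite xE take_cat sub sx ltnNge leq_addr addKn.
  have ssr : size (take (size s) r) = size s.
    by have := congr1 size xub; rewrite sx size_cat sub => /addnI.
  have Lx : iet_language (rcons u b ++ take (size s) r).
    apply: (@tree_catl _ _ tL _ (drop (size s) r)); rewrite -catA cat_take_drop.
    exact: (@tree_catr _ _ tL [:: a]).
  have := fwds _ _ sub Lx wub.
  by rewrite ssr -xub /x drop_size_cat.
have const v v' : size v = n.+1 -> size v' = n.+1 -> iet_language v ->
    iet_language v' -> infix w v = infix w v'.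
  move=> sv sv' Lv Lv'.
  pose J v (_ : unit) := infix w v; rewrite -[LHS]/(J v tt) -[RHS]/(J v' tt).
  apply: (tree_descent tL (n := n) (J := J) (D := fun=> setT) (tau := fun _ =>
    id)
    (beta := fun _ => id)) => //; first by move=> b.
  by move=> a u b [] su Laub _; apply/idP/idP;
    [apply: bwd Laub | apply: fwd Laub].
have [s ss Ls] := tree_extl_size tL (n.+1 - size w)%N Lw.
have sw : (size w <= n.+1)%N by apply: leqW; apply: leq_maxr.
move=> v Lv nv; apply: (@infix_trans _ (take n.+1 v));
  last exact/prefixW/prefix_take.
rewrite (const _ (s ++ w)) ?suffix_infix ?size_takel ?size_cat ?ss ?subnK //.
by apply: (@tree_catl _ _ tL _ (drop n.+1 v)); rewrite cat_take_drop.
Qed.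

(** By uniform recurrence, a long enough prefix of the coding contains any given word of the
    language; hence the independence from [z]. *)
Lemma factors_language z (u : nat -> A) : in_unit z -> natural_coding T z u ->
  factors u = iet_language.
Proof.
move=> z1 zu; have tL := iet_tree_language.
have coded i m : codes (mkseq (fun k => u (i + k)%N) m) (iter i F z).
  elim: m => // m IH; rewrite mkseqS codes_rcons IH size_mkseq -iterD addnC.
  by rewrite -in_pieceE; apply/zu.
have sub w : factors u w -> iet_language w.
  move=> [i ->]; exists (iter i F z); first exact: iet_iter_unit.
  exact: coded.
apply/seteqP; split => // w Lw; have [n nE] := iet_uniformly_recurrent Lw.
pose v := mkseq (fun k => u (0 + k)%N) n.
have /infixP[s [t vE]] : infix w v.
  apply: nE; last by rewrite size_mkseq.
  by apply: sub; exists 0%N; rewrite size_mkseq.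
have sn : (size s + (size w + size t))%N = n
  by rewrite -!size_cat -vE size_mkseq.
exists (size s); have [->|x0] := eqVneq w [::]; first by [].
case: w x0 vE sn {Lw nE} => // x w _ vE sn.
apply: (@eq_from_nth _ x); first by rewrite size_mkseq.
move=> i iw; rewrite nth_mkseq //.
have -> : nth x (x :: w) i = nth x v (size s + i)%N.
  rewrite vE nth_cat ifF; last by rewrite ltnNge leq_addr.
  by rewrite addKn nth_cat iw.
by rewrite nth_mkseq // -sn ltn_add2l ltn_addr.
Qed.

End Regular.
End IntervalExchange.

Theorem theorem4p5 (R : realType) (A : finType) (S : set (seq A))
    (hS : regular_interval_exchange_set R S) :
  finite_index_basis_property S.
Proof.
case: hS => T [regT [z [u [z1 zu ->]]]].
rewrite (factors_language regT _ zu); last by rewrite in_itv in z1.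
by apply: tree_finite_index_basis;
  [apply: iet_tree_language | apply: iet_uniformly_recurrent].
Qed.
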